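(* The glueing invariant $G(K)=\sum_d \mathrm{sgn}(d)\,[K^d_{glue}]$ is an invariant of framed virtual knots, is a Vassiliev invariant of order one, and is the universal Vassiliev invariant of order one of framed virtual knots, in the following sense: for every Vassiliev invariant $V$ of framed virtual knots of order $\le 1$ with values in an abelian group, and for every pair of homotopic framed virtual knots $K,K_0$, the element $\tfrac12\bigl(G(K)-G(K_0)\bigr)$ is a well-defined element of the free abelian group in which $G$ takes values, and $$V(K)=V(K_0)+V^{(1)}\Bigl(\tfrac12\bigl(G(K)-G(K_0)\bigr)\Bigr).$$
   Context: A virtual knot diagram is a generic immersion of an oriented circle in the plane, each double point being decorated either as a classical crossing (with over/under information, hence a sign $\pm1$) or as a virtual crossing. Virtual knots are diagrams modulo planar isotopy, the classical Reidemeister moves 1, 2, 3, the purely virtual Reidemeister moves 1, 2, 3, and the mixed move (sliding an arc carrying only virtual crossings past a classical crossing). Framed virtual knots are defined in the same way, except that classical Reidemeister move 1 is replaced by the framed Reidemeister move 1, which inserts or removes on an arc two consecutive kinks whose classical crossings have opposite signs (virtual Reidemeister 1 is still allowed). Two framed virtual knots are homotopic if they are related by planar isotopy, the classical Reidemeister moves 2, 3, the purely virtual Reidemeister moves 1, 2, 3, the mixed move and the framed Reidemeister move 1, together with crossing changes (CC) at classical crossings (for unframed virtual knots, the framed Reidemeister move 1 is replaced by the classical Reidemeister move 1). Flat framed virtual knots are equivalence classes under these moves; equivalently, over/under information at classical crossings is forgotten. A singular framed virtual knot may also have finitely many transverse double points. Singular knots are taken modulo planar isotopy, the classical Reidemeister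 moves 2, 3, the purely virtual Reidemeister moves 1, 2, 3, the mixed move, the framed Reidemeister move 1, and rigid vertex isotopy: an arc may be slid over, under, or virtually across a double point, and a double point followed by a classical crossing of the same two strands may be replaced by that classical crossing followed by the double point. The flat equivalence class of a singular knot is its class when crossing changes at classical crossings are also allowed (double points are kept). A knot invariant $\nu$ with values in an abelian group is extended to singular knots by $\nu(K_\bullet)=\nu(K_+)-\nu(K_-)$, where $K_\pm$ replace a double point by a positive/negative crossing. It is a Vassiliev (finite-type) invariant of order $\le n$ if it vanishes on all knots with more than $n$ double points; it has order one if it has order $\le1$ but is not of order $\le 0$. If $V$ has order $\le 1$, its extension $V^{(1)}$ to knots with exactly one double point depends only on the flat equivalence class of the singular knot; $V^{(1)}$ is extended linearly to the free abelian group on these classes. For a framed virtual knot diagram $K$ and a classical crossing $d$, $[K^d_{glue}]$ is the flat (framed) equivalence class of the singular knot obtained by replacing $d$ by a double point. The sum defining $G(K)$ is over all classical crossings $d$ of $K$, and $G(K)$ lies in the free abelian group generated by flat equivalence classes of singular framed virtual knots with exactly one double point. *)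

(* Defs.v *)
From HB Require Import structures.
From Stdlib Require Import Relation_Operators.
From mathcomp Require Import all_boot all_order all_algebra.
From mathcomp Require Import zify boolp.
From mathcomp Require Import freeg.

Set Implicit Arguments.
Unset Strict Implicit.
Unset Printing Implicit Defensive.

Import GRing.Theory.
Local Open Scope ring_scope.

(* A generic immersed curve in the plane is put in Morse position with respect
   to the height and cut into horizontal slices, each containing one minimum
   ([Cup]), one maximum ([Cap]) or one double point of the immersion ([Cross]).
   A diagram is the list of its slices, read from bottom to top.

   In [Cross c] the strand going from bottom left to top right is called the
   "/" strand, the other one the "\" strand; [Over] means that "/" is over "\".
   [Virtual] is a virtual crossing, [Double] a transverse double point of a
   singular knot. *)
Inductive decoration := Over | Under | Virtual | Double.

(* [Cup o]: [o] is the orientation of the left strand, [true] being upwards. *)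
Inductive piece := Cup of bool | Cap | Cross of decoration.

Definition decoration_code c : bool * bool :=
  match c with
  | Over => (true, true) | Under => (true, false)
  | Virtual => (false, true) | Double => (false, false)
  end.
Definition decoration_decode (x : bool * bool) : decoration :=
  if x.1 then (if x.2 then Over else Under)
  else (if x.2 then Virtual else Double).
Lemma decoration_codeK : cancel decoration_code decoration_decode.
Proof. by case. Qed.
HB.instance Definition _ :=
  Countable.copy decoration (can_type decoration_codeK).

Definition piece_code e : option (bool + decoration) :=
  match e with Cup o => Some (inl o) | Cap => None | Cross c => Some (inr c) end.
Definition piece_decode (x : option (bool + decoration)) : piece :=
  match x with
  | Some (inl o) => Cup o | None => Cap | Some (inr c) => Cross c
  end.
Lemma piece_codeK : cancel piece_code piece_decode.
Proof. by case. Qed.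
HB.instance Definition _ := Countable.copy piece (can_type piece_codeK).

(* [(i, e)]: the piece [e] with exactly [i] vertical strands to its left. *)
Definition slice : Type := (nat * piece)%type.
Notation word := (seq slice).

Definition win (e : piece) : nat := if e is Cup _ then 0 else 2.
Definition wout (e : piece) : nat := if e is Cap then 0 else 2.

(* The orientations of the strands met by a horizontal line, left to right. *)
Definition step (st : seq bool) (s : slice) : option (seq bool) :=
  let: (i, e) := s in
  match e with
  | Cup o => if (i <= size st)%N
             then Some (take i st ++ [:: o; ~~ o] ++ drop i st) else None
  | Cap => if drop i st is a :: b :: r
           then (if a != b then Some (take i st ++ r) else None) else None
  | Cross _ => if drop i st is a :: b :: r
               then Some (take i st ++ b :: a :: r) else None
  end.

Fixpoint run (st : seq bool) (w : word) : option (seq bool) :=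
  if w is s :: w' then obind (fun st' => run st' w') (step st s) else Some st.

(* [level w k] is read on the horizontal line just below slice [k]. *)
Definition level (w : word) (k : nat) : seq bool :=
  odflt [::] (run [::] (take k w)).

Definition slice_at (w : word) (k : nat) : slice := nth (0%N, Cap) w k.

(* Arcs are represented by points [(k, j)]: the [j]-th strand on the line just
   below slice [k]. *)
Definition is_point (w : word) (p : nat * nat) : Prop :=
  (p.1 <= size w)%N /\ (p.2 < size (level w p.1))%N.

(* Position above a slice of the strand entering it at position [j]; [None] if
   that strand ends at a maximum. *)
Definition through (s : slice) (j : nat) : option nat :=
  let: (i, e) := s in
  match e with
  | Cup _ => Some (if j < i then j else j.+2)%N
  | Cap => if (j < i)%N then Some j else if (j < i.+2)%N then None else Some j.-2
  | Cross _ => Some (if j == i then i.+1 else if j == i.+1 then i else j)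
  end.

Inductive joined (w : word) : nat * nat -> nat * nat -> Prop :=
| Joined_through k j j' :
    (k < size w)%N -> (j < size (level w k))%N ->
    through (slice_at w k) j = Some j' -> joined w (k, j) (k.+1, j')
| Joined_cup k i o :
    (k < size w)%N -> slice_at w k = (i, Cup o) ->
    joined w (k.+1, i) (k.+1, i.+1)
| Joined_cap k i :
    (k < size w)%N -> slice_at w k = (i, Cap) ->
    joined w (k, i) (k, i.+1).

(* The immersed curve is nonempty and is a single circle. *)
Definition one_component (w : word) : Prop :=
  (exists p, is_point w p) /\
  (forall p q, is_point w p -> is_point w q ->
     clos_refl_sym_trans _ (joined w) p q).

Definition is_knot (w : word) : bool :=
  (run [::] w == Some [::]) && `[< one_component w >].

Definition is_double (s : slice) : bool := s.2 == Cross Double.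
Definition is_classical (s : slice) : bool :=
  (s.2 == Cross Over) || (s.2 == Cross Under).
Definition ndouble (w : word) : nat := count is_double w.

Record sdiagram := SDiagram { word_of :> word; word_ofP : is_knot word_of }.
HB.instance Definition _ := [isSub for word_of].
HB.instance Definition _ := [Countable of sdiagram by <:].

Record diagram := Diagram { sdiag_of :> sdiagram; sdiag_ofP : ndouble sdiag_of == 0%N }.
HB.instance Definition _ := [isSub for sdiag_of].
HB.instance Definition _ := [Countable of diagram by <:].

Record diagram1 := Diagram1 { sdiag1_of :> sdiagram; sdiag1_ofP : ndouble sdiag1_of == 1%N }.
HB.instance Definition _ := [isSub for sdiag1_of].
HB.instance Definition _ := [Countable of diagram1 by <:].

(* Crossing change; it is also the effect on a [Cross] of turning the page by a
   quarter turn, since this exchanges the "/" and "\" strands. *)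
Definition swap (c : decoration) : decoration :=
  match c with Over => Under | Under => Over | _ => c end.

(* The elementary isotopies of plane curves in Morse position: two slices whose
   supports are side by side exchange heights; a minimum and a maximum cancel;
   a maximum or a minimum passes through a crossing. *)
Inductive planar_isotopy : word -> word -> Prop :=
| Exchange i d e f :
    planar_isotopy [:: (i, e); (i + wout e + d, f)]%N
                   [:: (i + win e + d, f); (i, e)]%N
| Zigzag i o : planar_isotopy [:: (i.+1, Cup o); (i, Cap)] [::]
| Zagzig i o : planar_isotopy [:: (i, Cup o); (i.+1, Cap)] [::]
| Turn_cap i c :
    planar_isotopy [:: (i, Cross c); (i.+1, Cap)]
                   [:: (i.+1, Cross (swap c)); (i, Cap)]
| Turn_cup i o c :
    planar_isotopy [:: (i, Cup o); (i.+1, Cross c)]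
                   [:: (i.+1, Cup o); (i, Cross (swap c))].

(* A vertical strand with a curl on its right or on its left. Whatever the
   orientation of the strand, the crossing of the curl is positive iff its
   decoration is [Over]. *)
Definition kink (right : bool) (i : nat) (o : bool) (c : decoration) : word :=
  if right then [:: (i.+1, Cup o); (i, Cross c); (i.+1, Cap)]
  else [:: (i, Cup o); (i.+1, Cross c); (i, Cap)].

Definition is_over_under (c : decoration) : bool := (c == Over) || (c == Under).

(* An arc crossing two strands in the manner [m] (over both, under both or
   virtually both) may be slid past the intersection [x] of these strands: this
   is the classical (m, x classical), virtual (m, x virtual) and mixed
   (m virtual, x classical) third move, and the slide across a double point.
   An arc going over or under two strands does not slide past their virtual
   crossing (this would be a forbidden move). *)
Definition may_slide (m x : decoration) : bool :=
  match m with
  | Virtual => true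
  | Double => false
  | Over | Under => x != Virtual
  end.

(* [triangle i a b c] and [triangle' i a b c]: three strands numbered 1, 2, 3
   from left to right at the bottom; [a], [b], [c] are the crossings of 1 and 2,
   of 1 and 3, of 2 and 3, the lower numbered strand being always "/". *)
Definition triangle (i : nat) (a b c : decoration) : word :=
  [:: (i, Cross a); (i.+1, Cross b); (i, Cross c)].
Definition triangle' (i : nat) (a b c : decoration) : word :=
  [:: (i.+1, Cross c); (i, Cross b); (i.+1, Cross a)].

(* The moves of (singular) framed virtual knots. On diagrams without double
   points the moves involving double points never apply. *)
Inductive framed_move : word -> word -> Prop :=
| Planar w w' : planar_isotopy w w' -> framed_move w w'
| Framed_R1 r r' i o o' c : is_over_under c ->
    framed_move (kink r i o c ++ kink r' i o' (swap c)) [::]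
| Virtual_R1 r i o : framed_move (kink r i o Virtual) [::]
| R2 i c : is_over_under c ->
    framed_move [:: (i, Cross c); (i, Cross (swap c))] [::]
| Virtual_R2 i : framed_move [:: (i, Cross Virtual); (i, Cross Virtual)] [::]
| Slide1 i m x : may_slide m x ->
    framed_move (triangle i m m x) (triangle' i m m x)
| Slide2 i m x : may_slide m x ->
    framed_move (triangle i (swap m) x m) (triangle' i (swap m) x m)
| Slide3 i m x : may_slide m x ->
    framed_move (triangle i x (swap m) (swap m)) (triangle' i x (swap m) (swap m))
| Rigid_twist i c : is_over_under c ->
    framed_move [:: (i, Cross Double); (i, Cross c)]
                [:: (i, Cross c); (i, Cross Double)].

Inductive flat_move : word -> word -> Prop :=
| Flat_framed w w' : framed_move w w' -> flat_move w w'
| Crossing_change i c : is_over_under c ->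
    flat_move [:: (i, Cross c)] [:: (i, Cross (swap c))].

Definition local_move (R : word -> word -> Prop) (S S' : sdiagram) : Prop :=
  exists u l r v, [/\ R l r, S = u ++ l ++ v :> word & S' = u ++ r ++ v :> word].

Definition framed_equiv : sdiagram -> sdiagram -> Prop :=
  clos_refl_sym_trans _ (local_move framed_move).
Definition flat_equiv : sdiagram -> sdiagram -> Prop :=
  clos_refl_sym_trans _ (local_move flat_move).

Definition homotopic (K K' : diagram) : Prop := flat_equiv K K'.

Definition flat_equiv1 (S S' : diagram1) : bool := `[< flat_equiv S S' >].

Lemma flat_equiv1_refl : reflexive flat_equiv1.
Proof. by move=> S; apply/asboolP/rst_refl. Qed.
Lemma flat_equiv1_sym : symmetric flat_equiv1.
Proof. by move=> S S'; apply/asboolP/asboolP; apply: rst_sym. Qed.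
Lemma flat_equiv1_trans : transitive flat_equiv1.
Proof.
by move=> S1 S S2 /asboolP e1 /asboolP e2; apply/asboolP; apply: rst_trans e2.
Qed.

Canonical flat_equiv1_equiv :=
  EquivRel flat_equiv1 flat_equiv1_refl flat_equiv1_sym flat_equiv1_trans.

Definition flat_class1 : Type := {eq_quot flat_equiv1}%qT.
HB.instance Definition _ := Choice.on flat_class1.
HB.instance Definition _ := Quotient.on flat_class1.

Definition class1 (S : diagram1) : flat_class1 := (\pi_flat_class1 S)%qT.

(* Do the two strands of the crossing in slice [k] both go up or both down? *)
Definition coherent (w : word) (k : nat) : bool :=
  let i := (slice_at w k).1 in
  nth false (level w k) i == nth false (level w k) i.+1.

(* Replaces the decoration of slice [k], if this slice is a crossing. *)
Definition set_word (w : word) (k : nat) (c : decoration) : word :=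
  if slice_at w k is (i, Cross _) then set_nth (0%N, Cap) w k (i, Cross c)
  else w.

Definition erase (s : slice) : slice :=
  if s is (i, Cross _) then (i, Cross Virtual) else s.

Lemma run_erase st w : run st (map erase w) = run st w.
Proof.
elim: w st => [//|s w IHw] st.
have stepE : step st (erase s) = step st s by case: s => i [].
by rewrite [map _ _]/= [LHS]/= stepE [RHS]/=; case: (step st s) => //= st'.
Qed.

Lemma level_erase w k : level (map erase w) k = level w k.
Proof. by rewrite /level -map_take run_erase. Qed.

Lemma slice_at_erase w k : slice_at (map erase w) k = erase (slice_at w k).
Proof.
rewrite /slice_at; have [lt_kw | le_wk] := ltnP k (size w).
  by rewrite (nth_map (0%N, Cap)).
by rewrite !nth_default ?size_map.
Qed.

Lemma joined_erase w p q : joined (map erase w) p q <-> joined w p q.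
Proof.
split; case=> k.
- move=> j j'; rewrite size_map level_erase slice_at_erase => lt_kw lt_j tj.
  by apply: Joined_through => //; rewrite -tj; case: slice_at => i [].
- move=> i o; rewrite size_map slice_at_erase => lt_kw sE.
  by apply: (@Joined_cup w k i o) => //; case: slice_at sE => i' [].
- move=> i; rewrite size_map slice_at_erase => lt_kw sE.
  by apply: Joined_cap => //; case: slice_at sE => i' [].
- move=> j j' lt_kw lt_j tj; apply: Joined_through; rewrite ?size_map //.
    by rewrite level_erase.
  by rewrite slice_at_erase -tj; case: slice_at => i [].
- move=> i o lt_kw sE; apply: (@Joined_cup _ k i o); rewrite ?size_map //.
  by rewrite slice_at_erase sE.
- move=> i lt_kw sE; apply: Joined_cap; rewrite ?size_map //.
  by rewrite slice_at_erase sE.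
Qed.

Lemma is_point_erase w p : is_point (map erase w) p <-> is_point w p.
Proof. by rewrite /is_point size_map level_erase. Qed.

Lemma is_knot_erase w : is_knot (map erase w) = is_knot w.
Proof.
rewrite /is_knot run_erase; congr (_ && _); apply: asbool_equiv_eq.
have joinE p q : clos_refl_sym_trans _ (joined (map erase w)) p q
                 <-> clos_refl_sym_trans _ (joined w) p q.
  split; elim=> [x y xy | x | x y _ | x y z _ xy _ yz].
  - exact/rst_step/joined_erase.
  - exact: rst_refl.
  - exact: rst_sym.
  - exact: rst_trans xy yz.
  - exact/rst_step/joined_erase.
  - exact: rst_refl.
  - exact: rst_sym.
  - exact: rst_trans xy yz.
split=> -[[p pP] conn]; split.
- by exists p; apply/is_point_erase.
- by move=> x y xP yP; apply/joinE/conn; apply/is_point_erase.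
- by exists p; apply/is_point_erase.
- by move=> x y /is_point_erase xP /is_point_erase yP; apply/joinE/conn.
Qed.

Lemma size_set_word w k c : size (set_word w k c) = size w.
Proof.
rewrite /set_word; have [lt_kw | le_wk] := ltnP k (size w); last first.
  by rewrite /slice_at nth_default.
case: slice_at => i [] // c'; rewrite size_set_nth; exact/maxn_idPr.
Qed.

Lemma slice_at_set w k c j :
  slice_at (set_word w k c) j =
  if j == k then (if slice_at w k is (i, Cross _) then (i, Cross c)
                  else slice_at w k) else slice_at w j.
Proof.
rewrite /set_word; case E: (slice_at w k) => [i [o||c']]; try
  by case: eqVneq => [->|//]; rewrite E.
by rewrite /slice_at nth_set_nth /=.
Qed.

Lemma erase_set w k c : map erase (set_word w k c) = map erase w.
Proof.
apply: (@eq_from_nth _ (0%N, Cap)) => [|j]; first by rewrite !size_map size_set_word.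
rewrite size_map => _; rewrite -/(slice_at _ j) -/(slice_at (map _ w) j).
rewrite !slice_at_erase slice_at_set.
by case: eqVneq => [->|//]; case: slice_at => i [].
Qed.

Lemma set_word_knot w k c : is_knot w -> is_knot (set_word w k c).
Proof. by rewrite -[is_knot w]is_knot_erase -(erase_set w k c) is_knot_erase. Qed.

Lemma coherent_set w k c j : coherent (set_word w k c) j = coherent w j.
Proof.
rewrite /coherent -(level_erase (set_word w k c)) erase_set level_erase.
suff -> : (slice_at (set_word w k c) j).1 = (slice_at w j).1 by [].
by rewrite slice_at_set; case: eqVneq => [->|//]; case: slice_at => i [].
Qed.

Lemma count_set_word a w k c : (k < size w)%N ->
  (count a (set_word w k c) + a (slice_at w k) =
   count a w + a (slice_at (set_word w k c) k))%N.
Proof.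
move=> lt_kw; rewrite slice_at_set eqxx /set_word.
case E: (slice_at w k) => [i [o||c']] //.
rewrite -{2}(cat_take_drop k w) (drop_nth (0%N, Cap) lt_kw) -/(slice_at w k) E.
rewrite set_nthE lt_kw !count_cat /= -!addnA; congr addn.
move: (nat_of_bool _) (nat_of_bool _) => x y; lia.
Qed.

Definition set_decoration (S : sdiagram) (k : nat) (c : decoration) : sdiagram :=
  SDiagram (set_word_knot k c (word_ofP S)).

(* The decoration of a crossing of given sign: when both strands go up, the
   crossing is positive iff the strand going to the right is over, and reversing
   one strand changes the sign. *)
Definition signed (positive coh : bool) : decoration :=
  if positive == coh then Over else Under.

Definition sign_at (w : word) (k : nat) : int :=
  if ((slice_at w k).2 == Cross Over) == coherent w k then 1 else -1.

Definition resolve (S : sdiagram) (k : nat) (positive : bool) : sdiagram :=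
  set_decoration S k (signed positive (coherent S k)).

(* [extend V] is the extension of [V] to singular knots; double points are
   resolved one after the other from bottom to top. By [extend_diagram] and
   [extend_skein] below the order is irrelevant. The last [else 0] is never
   reached when [n = ndouble S]. *)
Fixpoint extend_rec (A : zmodType) (V : diagram -> A) (n : nat) (S : sdiagram) : A :=
  if insub S is Some K then V K
  else if n is n'.+1 then
    let k := find is_double S in
    extend_rec V n' (resolve S k true) - extend_rec V n' (resolve S k false)
  else 0.

Definition extend (A : zmodType) (V : diagram -> A) (S : sdiagram) : A :=
  extend_rec V (ndouble S) S.

Lemma is_double_lt w k : is_double (slice_at w k) -> (k < size w)%N.
Proof. by rewrite ltnNge; apply: contraL => le_wk; rewrite /slice_at nth_default. Qed.

Lemma is_double_resolve (S : sdiagram) k p j : is_double (slice_at S k) ->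
  is_double (slice_at (resolve S k p) j) = (j != k) && is_double (slice_at S j).
Proof.
move=> kD; rewrite slice_at_set; case: eqVneq => //= _.
by move: kD; case: slice_at => i [] // c _; rewrite /signed; case: ifP.
Qed.

Lemma ndouble_resolve (S : sdiagram) k p : is_double (slice_at S k) ->
  ndouble S = (ndouble (resolve S k p)).+1.
Proof.
move=> kD; have := count_set_word is_double (signed p (coherent S k)) (is_double_lt kD).
rewrite kD (_ : is_double (slice_at (set_word _ _ _) _) = false).
  by rewrite addn0 addn1.
by rewrite -[set_word _ _ _]/(word_of (resolve S k p)) is_double_resolve ?eqxx.
Qed.

Lemma resolveC (S : sdiagram) j k p q : j != k ->
  resolve (resolve S j p) k q = resolve (resolve S k q) j p.
Proof.
move=> jk; apply: val_inj; rewrite /= !coherent_set.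
apply: (@eq_from_nth _ (0%N, Cap)) => [|i _]; first by rewrite !size_set_word.
rewrite -!/(slice_at _ i) !slice_at_set (negPf jk) [k == j]eq_sym (negPf jk).
by case: (eqVneq i k) => // ->; rewrite eq_sym (negPf jk).
Qed.

Lemma find_double (S : sdiagram) k : is_double (slice_at S k) ->
  (forall j, (j < k)%N -> ~~ is_double (slice_at S j)) -> find is_double S = k.
Proof.
move=> kD kmin; have hasD : has is_double S.
  by apply/(has_nthP (0%N, Cap)); exists k => //; apply: is_double_lt.
apply/eqP; rewrite eqn_leq leqNgt [X in _ && X]leqNgt; apply/andP; split.
  by apply/negP => /(before_find (0%N, Cap)); rewrite -/(slice_at _ k) kD.
by apply/negP => /kmin; rewrite /slice_at nth_find.
Qed.

Lemma extend_diagram (A : zmodType) (V : diagram -> A) (K : diagram) :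
  extend V K = V K.
Proof. by rewrite /extend; case: ndouble => [|n] /=; rewrite (valK K). Qed.

Lemma extend_find (A : zmodType) (V : diagram -> A) (S : sdiagram) k :
  is_double (slice_at S k) ->
  (forall j, (j < k)%N -> ~~ is_double (slice_at S j)) ->
  extend V S = extend V (resolve S k true) - extend V (resolve S k false).
Proof.
move=> kD kmin; have nS p := ndouble_resolve p kD.
rewrite [LHS]/extend (nS true) /= insubN ?(nS true) // (find_double kD kmin).
by congr (_ - _); rewrite /extend; congr extend_rec; apply: succn_inj; rewrite -!nS.
Qed.

Lemma extend_skein (A : zmodType) (V : diagram -> A) (S : sdiagram) k :
  is_double (slice_at S k) ->
  extend V S = extend V (resolve S k true) - extend V (resolve S k false).
Proof.
have [n] := ubnP (ndouble S); elim: n => // n IHn in S k * => ltSn kD.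
have [m mD mmin] := @ex_minnP (fun j => is_double (slice_at S j)) (ex_intro _ k kD).
have mlt j : (j < m)%N -> ~~ is_double (slice_at S j).
  by move=> ltjm; apply/negP => /mmin; rewrite leqNgt ltjm.
have [km | km] := eqVneq k m; first by rewrite km; apply: extend_find.
rewrite (extend_find V mD mlt).
have step1 p : extend V (resolve S m p) =
    extend V (resolve (resolve S m p) k true)
    - extend V (resolve (resolve S m p) k false).
  apply: IHn; last by rewrite is_double_resolve // km.
  by move: ltSn; rewrite (ndouble_resolve p mD).
have step2 p : extend V (resolve S k p) =
    extend V (resolve (resolve S k p) m true)
    - extend V (resolve (resolve S k p) m false).
  apply: extend_find; first by rewrite is_double_resolve // eq_sym km.
  by move=> j ltjm; rewrite is_double_resolve // negb_and mlt ?orbT.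
rewrite !{}step1 !{}step2 !(resolveC _ _ _ km) !opprB.
by rewrite addrACA [RHS]addrACA; congr (_ + _); apply: addrC.
Qed.

Definition framed_invariant (A : zmodType) (V : diagram -> A) : Prop :=
  forall K K' : diagram, framed_equiv K K' -> V K = V K'.

Definition vassiliev_le (A : zmodType) (n : nat) (V : diagram -> A) : Prop :=
  framed_invariant V /\
  forall S : sdiagram, (n < ndouble S)%N -> extend V S = 0.

Definition vassiliev_order_one (A : zmodType) (V : diagram -> A) : Prop :=
  vassiliev_le 1 V /\ ~ vassiliev_le 0 V.

(* The linear map on the free abelian group sending the class of a singular knot
   with one double point to the value of [extend V] on a representative. This is
   independent of the representative as soon as [V] has order at most 1.
   [zmodule A] is [A] seen as a module over the integers. *)
Definition extend1 (A : zmodType) (V : diagram -> A) (x : {freeg flat_class1}) : A :=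
  fglift (fun c : flat_class1 => extend V (repr c) : zmodule A) x.

Definition crossing (K : diagram) : finType :=
  {k : 'I_(size K) | is_classical (slice_at K k)}.

Lemma glue_subproof (K : diagram) (d : crossing K) :
  ndouble (set_decoration K (val (val d)) Double) == 1%N.
Proof.
case: d => -[k lt_kK] /= kP; have /eqP := sdiag_ofP K; rewrite /ndouble => K0.
have := count_set_word is_double Double lt_kK.
rewrite K0 slice_at_set eqxx.
by move: kP; case: slice_at => i [o||[]] //= _; rewrite addn0 => ->.
Qed.

Definition glue (K : diagram) (d : crossing K) : diagram1 :=
  Diagram1 (glue_subproof d).

Definition sgn (K : diagram) (d : crossing K) : int := sign_at K (val (val d)).

Definition glueing (K : diagram) : {freeg flat_class1} :=
  \sum_(d : crossing K) sgn d *: << class1 (glue d) >>.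

(* Main.v *)
Require Import Defs.
From Stdlib Require Import Relation_Operators.
From mathcomp Require Import all_boot all_order all_algebra.
From mathcomp Require Import zify boolp freeg.

Set Implicit Arguments.
Unset Strict Implicit.
Unset Printing Implicit Defensive.

Import GRing.Theory.
Local Open Scope ring_scope.

(* A crossing change at d leaves the flat class of every other glued diagram
   unchanged and flips sgn(d), so it changes G by 2 sgn(d) [K^d_glue], while it
   changes V by sgn(d) V^(1)(K^d_glue).  Since V^(1) only sees flat classes, the
   formula for V follows by adding up the crossing changes of a homotopy, and
   extending G to singular knots gives twice the class of a knot with one double
   point, hence 0 as soon as there are two.

   Each framed move matches the crossings before and after it with equal signs
   and glued diagrams, or cancels them in pairs.  The delicate case is the framed
   first move: a curl with a double point followed by a curl must be flatly
   equivalent to the same pair with the double point on the other curl.  Up to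
   flat equivalence, curls with a classical crossing can be created in pairs and
   have no preferred side, a curl with a double point can be turned to the other
   side of its strand at the price of two cancelling curls, and it can be slid
   all the way along a neighbouring curl.

   The intermediate diagrams have to be knots.  The number of components is
   controlled by counting the colourings of a diagram by two colours, which can
   be done one slice at a time. *)

(** * Runs and colourings *)

(** That [V^(1)] depends only on flat classes is proved, not assumed. When a framed move meets the
    double point, the two sides are resolved with the same sign, and the resolutions differ by the
    same move with a classical crossing in place of the double point; for rigid vertex isotopy they
    are equal words or cancel by second moves. Order at most one is used for crossing changes alone.

    Classes exist for knots only, and a homotopy may pass only through knots, while glued diagrams
    and auxiliary curls arise by surgery on words. Equivalence of tangles therefore carries equality
    of knottedness along, and words that are not knots get class zero. Connectivity itself is a
    relation on all points of a word, which a move renumbers; the colouring count replaces it by a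
    quantity that factors through the strands at the two ends of the tangle.

    Slices are indexed from the left, so local computations are made at index 0 and then translated,
    the strands on the right being the tail of the list of strands. *)

Definition shift (i : nat) (s : slice) : slice := (s.1 + i, s.2)%N.

Lemma take_sizeD (T : Type) (a t : seq T) j : take (j + size a) (a ++ t) = a ++ take j t.
Proof. by rewrite take_cat ltnNge leq_addl /= addnK. Qed.

Lemma drop_sizeD (T : Type) (a t : seq T) j : drop (j + size a) (a ++ t) = drop j t.
Proof. by rewrite drop_cat ltnNge leq_addl /= addnK. Qed.

(** Positions count strands from the left, so strands added there only translate indices. Strands on
    the right need no analogue: they belong to [t]. *)
Lemma step_shift a t s : step (a ++ t) (shift (size a) s) = omap (cat a) (step t s).
Proof.
case: s => j [o||c]; rewrite /step /= take_sizeD drop_sizeD.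
- by rewrite size_cat addnC leq_add2l; case: ifP => //= _; rewrite catA.
- case: (drop j t) => [|x [|y r]] //.
  by case: ifP => //= _; rewrite catA.
- case: (drop j t) => [|x [|y r]] //.
  by rewrite /= catA.
Qed.

Lemma run_cons st s w : run st (s :: w) = obind (fun st' => run st' w) (step st s).
Proof. by []. Qed.

Lemma run_seq1 st x : run st [:: x] = step st x.
Proof. by rewrite run_cons; case: step. Qed.

Lemma run_seq2 st x y : run st [:: x; y] = obind (step^~ y) (step st x).
Proof. by rewrite run_cons; case: (step st x) => //= st'; apply: run_seq1. Qed.

Lemma run_shift a t w :
  run (a ++ t) (map (shift (size a)) w) = omap (cat a) (run t w).
Proof.
elim: w t => // s w IHw t; rewrite map_cons !run_cons step_shift.
by case: (step t s) => // t'; apply: IHw.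
Qed.

Lemma run_cat st w1 w2 : run st (w1 ++ w2) = obind (fun st' => run st' w2) (run st w1).
Proof. by elim: w1 st => // s w1 IHw st; rewrite cat_cons !run_cons;
  case: (step st s) => //=. Qed.

Lemma run_cat_Some st w1 w2 st2 : run st (w1 ++ w2) = Some st2 ->
  exists2 st1, run st w1 = Some st1 & run st1 w2 = Some st2.
Proof. by rewrite run_cat; case: (run st w1) => //= st1; exists st1. Qed.

Lemma step_shift_le st i s : step st (shift i s) -> (i <= size st)%N.
Proof.
case: s => j e; case: (leqP i (size st)) => // lt_i; rewrite /shift /step /=.
have lt_ji : (size st < j + i)%N by apply: leq_trans lt_i (leq_addl j i).
by rewrite (drop_oversize (ltnW lt_ji)) [(j + i <= _)%N]leqNgt lt_ji; case: e.
Qed.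

(** The default value in [level] is never reached in a word that runs. *)
Lemma run_level w k : run [::] w -> (k <= size w)%N ->
  run [::] (take k w) = Some (level w k).
Proof.
move=> w_ok le_kw; rewrite /level; case E: run => //.
by move: w_ok; rewrite -(cat_take_drop k w) run_cat E.
Qed.

Lemma step_level w k : run [::] w -> (k < size w)%N ->
  step (level w k) (slice_at w k) = Some (level w k.+1).
Proof.
move=> w_ok lt_kw; have := run_level w_ok lt_kw.
rewrite (take_nth (0%N, Cap)) // -cats1 run_cat run_level 1?ltnW //=.
by rewrite -/(slice_at w k); case: step.
Qed.

(* A colouring of the strands by booleans, constant along each component,
   is found slice by slice; a diagram with n components has 2 ^ n of them. *)
Definition color_step (s : seq bool) (x : slice) : seq (seq bool) :=
  let: (i, e) := x in
  match e with
  | Cup _ => [seq take i s ++ [:: c; c] ++ drop i s | c <- [:: true; false]]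
  | Cap => if drop i s is a :: b :: r
           then (if a == b then [:: take i s ++ r] else [::]) else [::]
  | Cross _ => if drop i s is a :: b :: r
               then [:: take i s ++ b :: a :: r] else [::]
  end.

Fixpoint color_run (s : seq bool) (w : word) : seq (seq bool) :=
  if w is x :: w' then flatten [seq color_run t w' | t <- color_step s x]
  else [:: s].

Lemma color_step_shift a t s :
  color_step (a ++ t) (shift (size a) s) = map (cat a) (color_step t s).
Proof.
case: s => j [o||c]; rewrite /color_step /= take_sizeD drop_sizeD.
- by rewrite !catA.
- case: (drop j t) => [|x [|y r]] //.
  by case: ifP => //= _; rewrite catA.
- case: (drop j t) => [|x [|y r]] //.
  by rewrite /= catA.
Qed.

Lemma color_run_cons s x w :
  color_run s (x :: w) = flatten [seq color_run t w | t <- color_step s x].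
Proof. by []. Qed.

Lemma color_run_shift a t w :
  color_run (a ++ t) (map (shift (size a)) w) = map (cat a) (color_run t w).
Proof.
elim: w t => // s w IHw t; rewrite map_cons !color_run_cons color_step_shift -map_comp
  map_flatten -map_comp.
by congr flatten; apply: eq_map => t' /=; apply: IHw.
Qed.

Lemma color_run_cat s w1 w2 :
  color_run s (w1 ++ w2) = flatten [seq color_run t w2 | t <- color_run s w1].
Proof.
elim: w1 s => [|x w1 IHw] s /=; first by rewrite cats0.
rewrite map_flatten -map_comp.
elim: (color_step s x) => //= t ts IHt.
by rewrite IHw flatten_cat IHt.
Qed.

Lemma color_step_size st s st' x t : size s = size st -> step st x = Some st' ->
  t \in color_step s x -> size t = size st'.
Proof.
case: x => i [o||c] /= ss.
- case: ifP => // le_i [<-]; rewrite !inE => /orP[]/eqP->;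
    by rewrite !size_cat /= !size_take !size_drop ss.
- have := cat_take_drop i s; have := cat_take_drop i st.
  have : size (take i s) = size (take i st) by rewrite !size_take ss.
  case: (drop i st) => [|x [|y r]] //; case: ifP => // _.
  case: (drop i s) => [|x' [|y' r']] // e Est Es [<-]; case: ifP => // _.
  rewrite inE => /eqP->; move: ss; rewrite -{1}Est -{1}Es !size_cat /= e; lia.
- have := cat_take_drop i s; have := cat_take_drop i st.
  have : size (take i s) = size (take i st) by rewrite !size_take ss.
  case: (drop i st) => [|x [|y r]] //.
  case: (drop i s) => [|x' [|y' r']] // e Est Es [<-].
  rewrite inE => /eqP->; move: ss; rewrite -{1}Est -{1}Es !size_cat /= e; lia.
Qed.

Lemma color_run_size st s st' w t : size s = size st -> run st w = Some st' ->
  t \in color_run s w -> size t = size st'.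
Proof.
elim: w st s => [|x w IHw] st s ss; first by case=> <-; rewrite inE => /eqP->.
rewrite run_cons color_run_cons; case E: (step st x) => [st1|] // r1.
by case/flatten_mapP=> s1 /(color_step_size ss E) ss1; apply: IHw r1.
Qed.

(** The whole history of a colouring, level by level. Different colourings may end in the same
    colours, always so for a closed diagram; histories tell apart the repeated entries of
    [color_run]. *)
Fixpoint color_paths (s : seq bool) (w : word) : seq (seq (seq bool)) :=
  if w is x :: w' then
    flatten [seq map (cons s) (color_paths t w') | t <- color_step s x]
  else [:: [:: s]].

Lemma size_color_paths s w : size (color_paths s w) = size (color_run s w).
Proof.
elim: w s => //= x w IHw s.
elim: (color_step s x) => //= t ts IHt.
by rewrite !size_cat size_map IHt IHw.
Qed.

Lemma color_path_head s w p : p \in color_paths s w -> head [::] p = s.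
Proof.
case: w => [|x w] /=; first by rewrite inE => /eqP->.
by case/flatten_mapP=> t _ /mapP[q _ ->].
Qed.

Lemma uniq_color_step s x : uniq (color_step s x).
Proof.
case: x => i [o||c] /=.
- rewrite !inE andbT eqseq_cat // eqxx /= ; by [].
- by case: (drop i s) => [|a [|b r]] //; case: ifP.
- by case: (drop i s) => [|a [|b r]].
Qed.

Lemma uniq_color_paths s w : uniq (color_paths s w).
Proof.
elim: w s => //= x w IHw s; have := uniq_color_step s x.
elim: (color_step s x) => //= t ts IHt /andP[tts uts].
rewrite cat_uniq map_inj_uniq ?IHw ?IHt ?andbT //=; last by move=> a b [].
apply/hasPn => p /flatten_mapP[t' t'ts /mapP[q qP ->]].
apply/negP => /mapP[q' q'P [qq']]; move: tts.
by rewrite -(color_path_head q'P) -qq' (color_path_head qP) t'ts.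
Qed.

Lemma color_pathP s w p : reflect
  [/\ size p = (size w).+1, nth [::] p 0 = s &
      forall k, (k < size w)%N -> nth [::] p k.+1 \in color_step (nth [::] p k)
        (slice_at w k)]
  (p \in color_paths s w).
Proof.
elim: w s p => [|x w IHw] s p /=.
  rewrite inE; apply: (iffP eqP) => [->|[]] //.
  by case: p => [|s' []] //= _ ->.
apply: (iffP flatten_mapP) => [[t tP /mapP[q /IHw[sq q0 qS] ->]]|].
  split=> //=; first by rewrite sq.
  by case=> [_|k]; rewrite /slice_at /= ?q0 //; apply: qS.
case: p => [[]|s' p] //= [[sp] <- pS].
exists (nth [::] p 0); first exact: (pS 0%N).
apply: map_f; apply/IHw; split => // k lt_k.
exact: (pS k.+1).
Qed.

Ltac split_ltn := repeat first
  [ case: ltnP => ? | case: eqP => ? ]; try done; try (exfalso; lia).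

(** The three clauses mirror the three constructors of [joined], so that list surgery can be
    compared with connectivity of points. *)
Definition color_compat (s s' : seq bool) (x : slice) : Prop :=
  [/\ forall j j', (j < size s)%N -> through x j = Some j' ->
        nth false s j = nth false s' j',
      (if x.2 is Cup _ then nth false s' x.1 = nth false s' x.1.+1 else True) &
      (if x.2 is Cap then nth false s x.1 = nth false s x.1.+1 else True)].

Lemma size_drop2 (T : Type) (i : nat) (s : seq T) a b r :
  drop i s = a :: b :: r -> size s = (i + (size r).+2)%N.
Proof.
move=> E; have : size (drop i s) = (size r).+2 by rewrite E.
by rewrite size_drop; lia.
Qed.

Lemma nth_drop2 (i : nat) (s : seq bool) a b r : drop i s = a :: b :: r ->
  forall j, nth false s j =
    if (j < i)%N then nth false (take i s) j
    else if j == i then a else if j == i.+1 then b else nth false r (j - i.+2).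
Proof.
move=> E j; have ss := size_drop2 E.
rewrite -{1}(cat_take_drop i s) nth_cat size_takel; last by lia.
case: ltnP => // le_ij; rewrite E.
case: eqVneq => [->|ne]; first by rewrite subnn.
case: eqVneq => [->|ne1]; first by rewrite subSnn.
by rewrite (_ : (j - i = (j - i.+2).+2)%N) //; lia.
Qed.

Lemma color_stepP st st' s s' x : step st x = Some st' ->
  size s = size st -> size s' = size st' ->
  (s' \in color_step s x) <-> color_compat s s' x.
Proof.
case: x => i [o||c] stE ss ss'.
- move: stE; rewrite /step; case: ifP => // le_i [stE].
  have {}ss' : size s' = (size s).+2.
    by rewrite ss' -stE !size_cat /= size_take size_drop ss; case: ifP; lia.
  have nthE u j : nth false (take i s ++ [:: u; u] ++ drop i s) j =
      if (j < i)%N then nth false s j else if (j < i.+2)%N then u else nth false s j.-2.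
    rewrite nth_cat size_takel ?ss //; case: ltnP => [lt|le]; first by rewrite nth_take.
    rewrite nth_cat /=; case: ltnP => [lt|le2].
      rewrite (_ : (j < i.+2)%N = true); last by lia.
      by case: (j - i)%N lt => [|[|]].
    rewrite (_ : (j < i.+2)%N = false); last by lia.
    by rewrite nth_drop; congr nth; lia.
  split=> [|[thr /= cup _]].
    move=> /mapP[u _ sE]; split=> //=; last by rewrite sE !nthE; split_ltn.
    move=> j j' lt_j [<-]; rewrite sE nthE; case: (ltnP j i) => [->|le] //.
    rewrite (_ : (j.+2 < i)%N = false); last by lia.
    by rewrite (_ : (j.+2 < i.+2)%N = false) //; lia.
  suff -> : s' = take i s ++ [:: nth false s' i; nth false s' i] ++ drop i s.
    by rewrite !inE; case: nth; rewrite eqxx ?orbT.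
  apply: (@eq_from_nth _ false).
    by rewrite ss' !size_cat /= size_take size_drop ss; case: ifP; lia.
  move=> j; rewrite ss' => lt_j; rewrite nthE.
  case: ltnP => [lt|le]; first by rewrite (thr j j) /= ?lt //; lia.
  case: ltnP => [lt2|le2]; last first.
    rewrite (thr j.-2 j) //=; first by lia.
    by split_ltn; congr Some; lia.
  by have [->|->] : j = i \/ j = i.+1 by lia.
- move: stE; rewrite /step /color_step.
  case Est : (drop i st) => [|a [|b r]] //; case: ifP => // _ [stE].
  have := size_drop2 Est => sst.
  have {}ss' : size s' = (i + size r)%N.
    by rewrite ss' -stE size_cat size_takel //; lia.
  case Es : (drop i s) => [|a1 [|b1 r1]].
  - by have := congr1 size Es; rewrite size_drop /=; lia.
  - by have := congr1 size Es; rewrite size_drop /=; lia.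
  have nthE := nth_drop2 Es; have ss1 := size_drop2 Es.
  have ti : size (take i s) = i by rewrite size_takel //; lia.
  rewrite (_ : s' \in _ = (a1 == b1) && (s' == take i s ++ r1)); last first.
    by case: ifP; rewrite ?inE.
  split=> [/andP[/eqP ab /eqP sE]|[/= thr _]].
    split=> //=; last by rewrite !nthE; split_ltn.
    move=> j j' lt_j; rewrite sE nth_cat ti nthE; case: ltnP => [lt [<-]|le].
      by rewrite lt.
    case: ltnP => // le2 [<-].
    rewrite (_ : (j.-2 < i)%N = false); last by lia.
    do 2![case: eqP => [?|_]; first by lia].
    by congr nth; lia.
  have si : nth false s i = a1 by rewrite nthE; split_ltn.
  have siS : nth false s i.+1 = b1 by rewrite nthE; split_ltn.
  rewrite si siS => ab.
  rewrite ab eqxx /=; apply/eqP/(@eq_from_nth _ false).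
    by rewrite ss' size_cat ti; lia.
  move=> j; rewrite ss' => lt_j; rewrite nth_cat ti; case: ltnP => [lt|le].
    by rewrite -(thr j j) /= ?nthE ?lt //; lia.
  rewrite -(thr j.+2 j) /= ?nthE; first last.
  - by split_ltn.
  - by lia.
  by split_ltn.
- move: stE; rewrite /step /color_step.
  case Est : (drop i st) => [|a [|b r]] // [stE].
  have := size_drop2 Est => sst.
  have {}ss' : size s' = (i + (size r).+2)%N.
    by rewrite ss' -stE size_cat size_takel //; lia.
  case Es : (drop i s) => [|a1 [|b1 r1]].
  - by have := congr1 size Es; rewrite size_drop /=; lia.
  - by have := congr1 size Es; rewrite size_drop /=; lia.
  have nthE := nth_drop2 Es; have ss1 := size_drop2 Es.
  have ti : size (take i s) = i by rewrite size_takel //; lia.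
  have nthE' j : nth false (take i s ++ [:: b1, a1 & r1]) j =
      if j == i then b1 else if j == i.+1 then a1 else nth false s j.
    rewrite nth_cat ti nthE; case: ltnP => [lt|le].
      by do 2![case: eqP => [?|_]; first by lia].
    case: eqVneq => [->|ne]; first by rewrite subnn.
    case: eqVneq => [->|ne1]; first by rewrite subSnn.
    by rewrite (_ : (j - i = (j - i.+2).+2)%N) //; lia.
  have si : nth false s i = a1 by rewrite nthE; split_ltn.
  have siS : nth false s i.+1 = b1 by rewrite nthE; split_ltn.
  rewrite inE; split=> [/eqP sE|[/= thr _ _]].
    split=> //= j j' lt_j [<-]; rewrite sE nthE'.
    case: (eqVneq j i) => [->|ne]; first by rewrite (gtn_eqF (ltnSn i)) eqxx.
    case: (eqVneq j i.+1) => [->|ne1]; first by rewrite eqxx.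
    by rewrite (negPf ne) (negPf ne1).
  apply/eqP/(@eq_from_nth _ false).
    by rewrite ss' size_cat ti /=; lia.
  move=> j; rewrite ss' => lt_j; rewrite nthE'.
  case: eqVneq => [->|ne].
    by rewrite -(thr i.+1 i) /= ?siS ?eqxx ?(gtn_eqF (ltnSn i)) //; lia.
  case: eqVneq => [->|ne1].
    by rewrite -(thr i i.+1) /= ?si ?eqxx //; lia.
  by rewrite -(thr j j) /= ?(negPf ne) ?(negPf ne1) //; lia.
Qed.

(** * Colourings of points and connectedness *)

Definition coloring (w : word) (f : nat * nat -> bool) : Prop :=
  forall p q, joined w p q -> f p = f q.

(** Only the values of [f] at actual points of [w] are kept, so functions that agree there give the
    same path. *)
Definition color_path_of (w : word) (f : nat * nat -> bool) : seq (seq bool) :=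
  mkseq (fun k => mkseq (fun j => f (k, j)) (size (level w k))) (size w).+1.

Lemma color_path_sizes w p : run [::] w -> p \in color_paths [::] w ->
  forall k, (k <= size w)%N -> size (nth [::] p k) = size (level w k).
Proof.
move=> w_ok /color_pathP[_ p0 pS]; elim=> [|k IHk] lt_k; first by rewrite p0 /level take0.
have sE := step_level w_ok lt_k.
exact: color_step_size (IHk (ltnW lt_k)) sE (pS k lt_k).
Qed.

Lemma coloring_path w f : run [::] w -> coloring w f ->
  color_path_of w f \in color_paths [::] w.
Proof.
move=> w_ok fP.
have nthE k : (k <= size w)%N -> nth [::] (color_path_of w f) k =
    mkseq (fun j => f (k, j)) (size (level w k)).
  by move=> le_k; rewrite nth_mkseq.
apply/color_pathP; split; first by rewrite size_mkseq.
  by rewrite nthE // /level take0.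
move=> k lt_k; rewrite !nthE // 1?ltnW //.
have sE := step_level w_ok lt_k.
apply/(color_stepP sE); rewrite ?size_mkseq //.
have compat j j' : (j < size (level w k))%N -> through (slice_at w k) j = Some j' ->
    (j' < size (level w k.+1))%N.
  move: sE; case: slice_at => i [o||c] /=.
  - case: ifP => // le_i [<-] lt_j [<-]; rewrite !size_cat /= size_takel // size_drop.
    by case: (ltnP j i); lia.
  - case E: drop => [|a [|b r]] //; case: ifP => // _ [<-] lt_j.
    have := size_drop2 E => ss; rewrite size_cat size_takel; last by lia.
    by case: ltnP => [? [<-]|]; last (case: ltnP => // ? ? [<-]); lia.
  - case E: drop => [|a [|b r]] // [<-] lt_j [<-].
    have := size_drop2 E => ss; rewrite size_cat size_takel /=; last by lia.
    by repeat case: eqP => ?; lia.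
split.
- rewrite size_mkseq => j j' lt_j tj; rewrite !nth_mkseq //; last exact: compat tj.
  by apply: fP; apply: Joined_through.
- move: sE (@Joined_cup w k); case: slice_at => i [o||c] //=.
  case: ifP => // le_i [<-] J; rewrite !nth_mkseq; first by apply: fP; apply: J.
  + by rewrite !size_cat /= size_takel // size_drop; lia.
  + by rewrite !size_cat /= size_takel // size_drop; lia.
- move: sE (@Joined_cap w k); case: slice_at => i [o||c] //=.
  case E: drop => [|a [|b r]] //; have ss := size_drop2 E => _ J.
  rewrite !nth_mkseq; first by apply: fP; apply: J.
  + by lia.
  + by lia.
Qed.

Lemma color_path_coloring w p : run [::] w -> p \in color_paths [::] w ->
  coloring w (fun x => nth false (nth [::] p x.1) x.2).
Proof.
move=> w_ok pP; have sz := color_path_sizes w_ok pP.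
case/color_pathP: pP => _ _ pS.
have comp k : (k < size w)%N -> color_compat (nth [::] p k) (nth [::] p k.+1) (slice_at
  w k).
  by move=> lt_k; apply/(color_stepP (step_level w_ok lt_k)); rewrite ?sz ?pS // ltnW.
move=> x y; case=> k.
- move=> j j' lt_k lt_j tj; have [thr _ _] := comp k lt_k.
  by apply: thr tj; rewrite sz // ltnW.
- by move=> i o lt_k E; have [_] := comp k lt_k; rewrite E.
- by move=> i lt_k E; have [_ _] := comp k lt_k; rewrite E.
Qed.

Lemma coloring_conn w f p q : coloring w f ->
  clos_refl_sym_trans _ (joined w) p q -> f p = f q.
Proof. by move=> fP; elim=> // x y z _ -> _ ->. Qed.

Lemma color_path_nseq w p c : run [::] w -> p \in color_paths [::] w ->
  (forall k j, is_point w (k, j) -> nth false (nth [::] p k) j = c) ->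
  p = color_path_of w (fun=> c).
Proof.
move=> w_ok pP pc; have sz := color_path_sizes w_ok pP.
case/color_pathP: pP => sp _ _.
apply: (@eq_from_nth _ [::]); first by rewrite sp size_mkseq.
rewrite sp => k lt_k; rewrite nth_mkseq //.
apply: (@eq_from_nth _ false); first by rewrite size_mkseq sz.
by rewrite sz // => j lt_j; rewrite nth_mkseq // pc.
Qed.

(** The two constant colourings always exist and differ as soon as there is a point. Connectedness
    leaves no others; conversely, a second component would produce a nonconstant one. *)
Lemma one_component_colors w : run [::] w ->
  one_component w <-> size (color_run [::] w) = 2.
Proof.
move=> w_ok; rewrite -size_color_paths.
pose pc c := color_path_of w (fun=> c).
have pcP c : pc c \in color_paths [::] w by apply: coloring_path.
have nthc p c : is_point w p -> nth false (nth [::] (pc c) p.1) p.2 = c.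
  by case: p => k j [/= le_k lt_j]; rewrite /pc nth_mkseq // nth_mkseq.
split=> [[[p0 p0P] conn]|size2].
  suff : perm_eq (color_paths [::] w) [:: pc true; pc false] by move/perm_size.
  apply: uniq_perm; first exact: uniq_color_paths.
    rewrite /= andbT inE; apply/eqP => E.
    by have := nthc p0 true p0P; rewrite E nthc.
  move=> p; rewrite !inE; apply/idP/orP => [pP|[]/eqP->] //.
  have pE : p = pc (nth false (nth [::] p p0.1) p0.2).
    apply: color_path_nseq => // k j kjP.
    exact: (coloring_conn (color_path_coloring w_ok pP) (conn (k, j) p0 kjP p0P)).
  by rewrite pE; case: nth; rewrite eqxx; [left|right].
(* Without points all levels are empty and there is at most one path, not two. *)
have has_point : exists p, is_point w p.
  apply: contrapT => noP; suff : (size (color_paths [::] w) <= 1)%N by rewrite size2.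
  rewrite -[1%N]/(size [:: pc true]); apply: uniq_leq_size; first exact: uniq_color_paths.
  move=> p pP; rewrite inE; apply/eqP; apply: color_path_nseq => // k j kj.
  by case: noP; exists (k, j).
split=> // p q pP qP.
have ne : pc true != pc false.
  by case: has_point => x xP; apply/eqP => E; have := nthc x true xP; rewrite E nthc.
have mem r : r \in color_paths [::] w -> r = pc true \/ r = pc false.
  have : perm_eq [:: pc true; pc false] (color_paths [::] w).
    apply/uniq_perm; rewrite ?uniq_color_paths //=; first by rewrite inE ne.
    apply: (uniq_min_size _ _ _).2; rewrite ?size2 //=; first by rewrite inE ne.
    by move=> x; rewrite !inE => /orP[]/eqP->.
  by move/perm_mem=> <-; rewrite !inE => /orP[]/eqP->; [left|right].
(* The indicator function of the component of [p] is a colouring, [true] at [p]; only constant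
   colourings are available, so it is [true] at [q] as well. *)
pose f x := `[< clos_refl_sym_trans _ (joined w) p x >].
have fP : coloring w f.
  move=> x y xy; apply/asboolP/asboolP => c; apply: rst_trans c _.
    exact: rst_step.
  by apply: rst_sym; apply: rst_step.
have fE x : is_point w x -> nth false (nth [::] (color_path_of w f) x.1) x.2 = f x.
  by case: x => k j [/= le_k lt_j]; rewrite nth_mkseq // nth_mkseq.
apply/asboolP; rewrite -/(f q) -fE //.
have : f p = true by apply/asboolP/rst_refl.
rewrite -fE //; case: (mem _ (coloring_path w_ok fP)) => ->; rewrite !nthc //.
Qed.

Lemma is_knotE w :
  is_knot w = (run [::] w == Some [::]) && (size (color_run [::] w) == 2).
Proof.
rewrite /is_knot; case: eqP => //= w_ok.
have wP : one_component w <-> size (color_run [::] w) = 2.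
  by apply: one_component_colors; rewrite w_ok.
by apply/asboolP/eqP => /wP.
Qed.

(** Only the multiset of final colours of the middle piece matters, since the colourings of [v] are
    then summed over it. *)
Lemma is_knot_local u l r v st st' : run [::] u = Some st ->
  run st l = Some st' -> run st r = Some st' ->
  (forall s, size s = size st -> perm_eq (color_run s l) (color_run s r)) ->
  is_knot (u ++ l ++ v) = is_knot (u ++ r ++ v).
Proof.
move=> uE lE rE lr; rewrite !is_knotE.
have runE x : run st x = Some st' -> run [::] (u ++ x ++ v) = run st' v.
  by move=> xE; rewrite run_cat uE /= run_cat xE.
rewrite (runE l lE) (runE r rE); congr (_ && (_ == _)).
rewrite !color_run_cat [in LHS]size_flatten [in RHS]size_flatten /shape -!map_comp;
  congr sumn.
apply/eq_in_map => s sP /=; rewrite !color_run_cat.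
apply: perm_size; apply: perm_flatten; apply: perm_map; apply: lr.
exact: color_run_size uE sP.
Qed.

(** * Moves and components *)

(** Both sides are required to run because one side of a move is often [[::]], which runs on any
    strands, even where the other side is undefined. *)
Definition same_runs (l r : word) : Prop := forall st st1 st2,
  run st l = Some st1 -> run st r = Some st2 ->
  st1 = st2 /\
  forall s, size s = size st -> perm_eq (color_run s l) (color_run s r).

(** A nonempty translated word can only run if there are at least [i] strands, which can then be
    split off on the left. *)
Lemma same_runs_shift i l r : same_runs l r -> l <> [::] ->
  same_runs (map (shift i) l) (map (shift i) r).
Proof.
case: l => // x l lr _ st st1 st2 lE.
have le_i : (i <= size st)%N.
  apply: (@step_shift_le _ _ x); move: lE; rewrite map_cons run_cons.
  by case: step.
have [a [t [stE sa]]] : exists a t, st = a ++ t /\ size a = i.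
  by exists (take i st), (drop i st); rewrite cat_take_drop size_takel.
move: lE lr; generalize (x :: l) => {x}l lE; rewrite {}stE in lE *;
  rewrite -{i le_i}sa !run_shift in lE *; move: lE.
case lE: (run t l) => [t1|] // [<-] lr; case rE: (run t r) => [t2|] // [<-].
have [<- lrC] := lr _ _ _ lE rE; split=> // s; rewrite size_cat => ss.
have : size (take (size a) s) = size a by rewrite size_takel // ss leq_addr.
have : size (drop (size a) s) = size t by rewrite size_drop ss addKn.
have := cat_take_drop (size a) s; move: (take _ s) (drop _ s) => b s' <- ss' <-.
by rewrite !color_run_shift; apply/perm_map/lrC.
Qed.

Lemma step_left t e t1 : step t (0%N, e) = Some t1 ->
  exists x x' t', [/\ t = x ++ t', t1 = x' ++ t', size x = win e, size x' = wout e &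
    forall t'', step (x ++ t'') (0%N, e) = Some (x' ++ t'')].
Proof.
case: e => [o||c] /=.
- by rewrite take0 drop0 => -[<-]; exists [::], [:: o; ~~ o], t; split=> // t'';
    rewrite take0 drop0.
- case: t => [|a [|b t]] //=; case: ifP => // ab [<-].
  by exists [:: a; b], [::], t; split=> // t'' /=; rewrite ab.
- case: t => [|a [|b t]] //= [<-].
  by exists [:: a; b], [:: b; a], t.
Qed.

Lemma color_step_left y s e : size y = win e ->
  color_step (y ++ s) (0%N, e) = [seq y' ++ s | y' <- color_step y (0%N, e)] /\
  {in color_step y (0%N, e), forall y', size y' = wout e}.
Proof.
case: e => [o||c] /=.
- by case: y => // _; rewrite take0 drop0; split=> // y'; rewrite !inE => /orP[]/eqP->.
- case: y => [|a [|b []]] //= _; case: ifP => // _; split=> // y'.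
  by rewrite inE => /eqP->.
- case: y => [|a [|b []]] //= _; split=> // y'.
  by rewrite inE => /eqP->.
Qed.

Lemma perm_allpairs_swap (S T : Type) (R : eqType) (f : S -> T -> R) s t :
  perm_eq [seq f x y | x <- s, y <- t] [seq f x y | y <- t, x <- s].
Proof.
elim: t => [|y t IHt]; first by elim: s.
by rewrite perm_allpairs_consr perm_cat2l.
Qed.

(** The two slices act on disjoint blocks of strands, so the results are pairs enumerated in two
    different orders: this is why [same_runs] asks for a permutation and not for equality. *)
Lemma same_runs_exchange d e f :
  same_runs [:: (0%N, e); (wout e + d, f)%N] [:: (win e + d, f)%N; (0%N, e)].
Proof.
have shE a : (size a + d, f)%N = shift (size a) (d, f) by rewrite /shift /= addnC.
have crun1 s x : color_run s [:: x] = color_step s x.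
  by rewrite color_run_cons (eq_map (g := fun t => [:: t])) // flatten_seq1.
move=> st st1 st2; rewrite !run_seq2; case E: (step st (0%N, e)) => [t1|] //.
case/step_left: E => x [x'] [t'] [-> -> sx sx' ext].
rewrite -sx -sx' !shE step_shift.
rewrite (_ : obind _ (Some _) = step (x' ++ t') (shift (size x') (d, f))) // step_shift.
case F: (step t' (d, f)) => [t2|] // -[<-].
rewrite (_ : obind _ _ = step (x ++ t2) (0%N, e)) // ext => -[<-]; split=> // s.
rewrite size_cat => ss.
have sy : size (take (size x) s) = size x by rewrite size_takel // ss leq_addr.
have := cat_take_drop (size x) s; move: (take _ s) (drop _ s) sy => y s' sy <-.
rewrite !color_run_cons -sy color_step_shift.
have yC := color_step_left _ (etrans sy sx).
rewrite (yC s').1 -!map_comp.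
have -> : [seq ((color_run^~ [:: shift (size x') (d, f)]) \o (cat^~ s')) y' | y' <-
  color_step y (0%N, e)]
   = [seq [seq y' ++ s1 | s1 <- color_step s' (d, f)] | y' <- color_step y (0%N, e)].
  apply/eq_in_map => y' /(yC s').2 sy'.
  by rewrite [LHS]crun1 sx' -sy' color_step_shift.
have -> : [seq ((color_run^~ [:: (0%N, e)]) \o (cat y)) s1 | s1 <- color_step s' (d, f)]
   = [seq [seq y' ++ s1 | y' <- color_step y (0%N, e)] | s1 <- color_step s' (d, f)].
  by apply: eq_map => s1; rewrite [LHS]crun1 (yC s1).1.
exact: perm_allpairs_swap.
Qed.

(** These moves touch at most three strands, so once the first three entries of the lists are
    enumerated everything computes. *)
Ltac solve_same_runs :=
  let st := fresh "st" in let st1 := fresh "st" in let st2 := fresh "st" in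
  intros st st1 st2;
  destruct st as [|x [|y [|z st]]]; rewrite /kink /=; rewrite ?drop0 ?take0 //=;
  repeat match goal with b : bool |- _ => destruct b end;
  rewrite /= ?drop0 ?take0 //=;
  let s := fresh "s" in
  move=> [<-] [<-]; split=> // s;
  destruct s as [|x' [|y' [|z' s]]] => //=; rewrite ?drop0 ?take0 //=;
  repeat match goal with b : bool |- _ => destruct b end;
  rewrite /= ?drop0 ?take0 //=.

Lemma same_runs_zigzag o : same_runs [:: (1%N, Cup o); (0%N, Cap)] [::].
Proof. solve_same_runs. Qed.

Lemma same_runs_zagzig o : same_runs [:: (0%N, Cup o); (1%N, Cap)] [::].
Proof. solve_same_runs. Qed.

Lemma same_runs_turn_cap c c' :
  same_runs [:: (0%N, Cross c); (1%N, Cap)] [:: (1%N, Cross c'); (0%N, Cap)].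
Proof. solve_same_runs. Qed.

Lemma same_runs_turn_cup o c c' :
  same_runs [:: (0%N, Cup o); (1%N, Cross c)] [:: (1%N, Cup o); (0%N, Cross c')].
Proof. solve_same_runs. Qed.

Lemma same_runs_kink r o c : same_runs (kink r 0 o c) [::].
Proof. case: r; solve_same_runs. Qed.

Lemma same_runs_kinks r r' o o' c c' :
  same_runs (kink r 0 o c ++ kink r' 0 o' c') [::].
Proof. case: r; case: r'; solve_same_runs. Qed.

Lemma same_runs_cancel c c' :
  same_runs [:: (0%N, Cross c); (0%N, Cross c')] [::].
Proof. solve_same_runs. Qed.

Lemma same_runs_slide a b c a' b' c' :
  same_runs (triangle 0 a b c) (triangle' 0 a' b' c').
Proof. rewrite /triangle /triangle'; solve_same_runs. Qed.

Lemma same_runs_cross (l r : word) : map erase l = map erase r -> same_runs l r.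
Proof.
move=> lr st st1 st2; rewrite -run_erase lr run_erase => -> [->]; split=> // s _.
have E w t : color_run t (map erase w) = color_run t w.
  elim: w t => // x w IHw t; rewrite map_cons !color_run_cons (eq_map IHw).
  by case: x => i [].
by rewrite -E lr E.
Qed.

(* The framed moves, with no strand on their left. *)
Inductive base_move : word -> word -> Prop :=
| Base_exchange d e f :
    base_move [:: (0, e); (wout e + d, f)]%N [:: (win e + d, f); (0, e)]%N
| Base_zigzag o : base_move [:: (1, Cup o); (0, Cap)]%N [::]
| Base_zagzig o : base_move [:: (0, Cup o); (1, Cap)]%N [::]
| Base_turn_cap c :
    base_move [:: (0, Cross c); (1, Cap)]%N [:: (1, Cross (swap c)); (0, Cap)]%N
| Base_turn_cup o c :
    base_move [:: (0, Cup o); (1, Cross c)]%N [:: (1, Cup o); (0, Cross (swap c))]%N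
| Base_kinks r r' o o' c : is_over_under c ->
    base_move (kink r 0 o c ++ kink r' 0 o' (swap c)) [::]
| Base_virtual_kink r o : base_move (kink r 0 o Virtual) [::]
| Base_cancel c : is_over_under c ->
    base_move [:: (0, Cross c); (0, Cross (swap c))]%N [::]
| Base_virtual_cancel :
    base_move [:: (0, Cross Virtual); (0, Cross Virtual)]%N [::]
| Base_slide1 m x : may_slide m x ->
    base_move (triangle 0 m m x) (triangle' 0 m m x)
| Base_slide2 m x : may_slide m x ->
    base_move (triangle 0 (swap m) x m) (triangle' 0 (swap m) x m)
| Base_slide3 m x : may_slide m x ->
    base_move (triangle 0 x (swap m) (swap m)) (triangle' 0 x (swap m) (swap m))
| Base_twist c : is_over_under c ->
    base_move [:: (0, Cross Double); (0, Cross c)]%N [:: (0, Cross c);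
      (0, Cross Double)]%N.

Lemma framed_move_base l r : framed_move l r -> exists i l0 r0,
  [/\ l = map (shift i) l0, r = map (shift i) r0 & base_move l0 r0].
Proof.
case=> {l r} [l r []||||||||].
- move=> i d e f; exists i; eexists _, _; split; last exact: (Base_exchange d e f).
    by rewrite /= /shift /= -addnA addnC.
  by rewrite /= /shift /= -addnA addnC.
- by move=> i o; exists i; eexists _, _; split; last exact: (Base_zigzag o).
- by move=> i o; exists i; eexists _, _; split; last exact: (Base_zagzig o).
- by move=> i c; exists i; eexists _, _; split; last exact: (Base_turn_cap c).
- by move=> i o c; exists i; eexists _, _; split; last exact: (Base_turn_cup o c).
- move=> r r' i o o' c cP; exists i; eexists _, _; split;
    last exact: (Base_kinks r r' o o' cP).
    by rewrite map_cat; case: r; case: r'.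
  by [].
- by move=> r i o; exists i; eexists _, _; split;
    last exact: (Base_virtual_kink r o); case: r.
- by move=> i c cP; exists i; eexists _, _; split; last exact: (Base_cancel cP).
- by move=> i; exists i; eexists _, _; split; last exact: Base_virtual_cancel.
- by move=> i m x mx; exists i; eexists _, _; split; last exact: (Base_slide1 mx).
- by move=> i m x mx; exists i; eexists _, _; split; last exact: (Base_slide2 mx).
- by move=> i m x mx; exists i; eexists _, _; split; last exact: (Base_slide3 mx).
- by move=> i c cP; exists i; eexists _, _; split; last exact: (Base_twist cP).
Qed.

Lemma base_move_framed i l r : base_move l r ->
    framed_move (map (shift i) l) (map (shift i) r).
Proof.
case=> {l r}.
- move=> d e f; rewrite /= /shift /= ![(_ + i)%N]addnC addn0 !addnA;
    exact/Planar/Exchange.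
- by move=> o; apply/Planar/(Zigzag i o).
- by move=> o; apply/Planar/(Zagzig i o).
- by move=> c; apply/Planar/(Turn_cap i c).
- by move=> o c; apply/Planar/(Turn_cup i o c).
- by move=> r r' o o' c cP; rewrite map_cat; have := Framed_R1 r r' i o o' cP;
    case: r; case: r'.
- by move=> r o; have := Virtual_R1 r i o; case: r.
- by move=> c cP; apply: (R2 i cP).
- exact: (Virtual_R2 i).
- by move=> m x mx; apply: (Slide1 i mx).
- by move=> m x mx; apply: (Slide2 i mx).
- by move=> m x mx; apply: (Slide3 i mx).
- by move=> c cP; apply: (Rigid_twist i cP).
Qed.

Lemma base_move_nonempty l r : base_move l r -> l <> [::].
Proof. by case=> // -[]. Qed.

Lemma same_runs_base l r : base_move l r -> same_runs l r.
Proof.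
case=> {l r}.
- exact: same_runs_exchange.
- exact: same_runs_zigzag.
- exact: same_runs_zagzig.
- by move=> c; apply: same_runs_turn_cap.
- by move=> o c; apply: same_runs_turn_cup.
- by move=> r r' o o' c _; apply: same_runs_kinks.
- by move=> r o; apply: same_runs_kink.
- by move=> c _; apply: same_runs_cancel.
- exact: same_runs_cancel.
- by move=> m x _; apply: same_runs_slide.
- by move=> m x _; apply: same_runs_slide.
- by move=> m x _; apply: same_runs_slide.
- by move=> c _; apply: same_runs_cross.
Qed.

Lemma same_runs_move l r : flat_move l r -> same_runs l r.
Proof.
case=> [{}l {}r /framed_move_base[i [l0 [r0 [-> -> lr]]]]|i c _].
  exact: same_runs_shift (same_runs_base lr) (base_move_nonempty lr).
exact: same_runs_cross.
Qed.

Lemma is_knot_same_runs u l r v st st1 st2 : same_runs l r ->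
  run [::] u = Some st -> run st l = Some st1 -> run st r = Some st2 ->
  is_knot (u ++ l ++ v) = is_knot (u ++ r ++ v).
Proof.
move=> lr uE lE rE; have [E C] := lr _ _ _ lE rE.
by apply: (is_knot_local v uE lE _ C); rewrite rE E.
Qed.

(** * Flat equivalence of tangles *)

(** Stated on words so that chains can be written with concatenations; the proofs of knottedness
    stay inside the existentials. *)
Definition word_equiv (R : word -> word -> Prop) (w w' : word) : Prop :=
  exists S S' : sdiagram, [/\ S = w :> word, S' = w' :> word &
    clos_refl_sym_trans _ (local_move R) S S'].

Lemma word_equiv_trans R w1 w2 w3 :
  word_equiv R w1 w2 -> word_equiv R w2 w3 -> word_equiv R w1 w3.
Proof.
move=> [S1 [S2 [<- <- e12]]] [S2' [S3 [E <- e23]]]; exists S1, S3; split=> //.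
by move: e23; rewrite (val_inj E); apply: rst_trans.
Qed.

Lemma word_equiv_sym R w w' : word_equiv R w w' -> word_equiv R w' w.
Proof. by move=> [S [S' [<- <- e]]]; exists S', S; split=> //; apply: rst_sym. Qed.

Lemma word_equiv_refl R w : is_knot w -> word_equiv R w w.
Proof. by move=> wP; exists (SDiagram wP), (SDiagram wP); split=> //;
  apply: rst_refl. Qed.

Lemma word_equiv_move (R : word -> word -> Prop) u l r v : R l r ->
  is_knot (u ++ l ++ v) -> is_knot (u ++ r ++ v) ->
  word_equiv R (u ++ l ++ v) (u ++ r ++ v).
Proof.
move=> lr lP rP; exists (SDiagram lP), (SDiagram rP); split=> //.
by apply: rst_step; exists u, l, r, v.
Qed.

(* [t] lists the strands entering the two tangles, except the strands [a] that
   pass on their left; those that pass on their right may be part of [t]. *)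
Definition tangle_equiv (t : seq bool) (l r : word) : Prop :=
  (exists2 t', run t l = Some t' & run t r = Some t') /\
  forall a u v, run [::] u = Some (a ++ t) ->
    let w x := u ++ map (shift (size a)) x ++ v in
    is_knot (w l) = is_knot (w r) /\
    (is_knot (w l) -> word_equiv flat_move (w l) (w r)).

Lemma tangle_equiv_refl t l : run t l -> tangle_equiv t l l.
Proof.
case E: (run t l) => [t'|] // _; split; first by exists t'.
by move=> a u v _; split=> // ?; apply: word_equiv_refl.
Qed.

Lemma tangle_equiv_sym t l r : tangle_equiv t l r -> tangle_equiv t r l.
Proof.
move=> [[t' lE rE] lr]; split; first by exists t'.
move=> a u v uE /=; have [-> e] := lr a u v uE; split=> // k.
exact/word_equiv_sym/e.
Qed.

Lemma tangle_equiv_trans t l m r :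
  tangle_equiv t l m -> tangle_equiv t m r -> tangle_equiv t l r.
Proof.
move=> [[t' lE mE] lm] [[t'' mE' rE] mr]; split.
  by exists t'; rewrite // rE -mE' mE.
move=> a u v uE; have [k1 e1] := lm a u v uE; have [k2 e2] := mr a u v uE.
split; first by rewrite k1.
by move=> k; apply: word_equiv_trans (e1 k) (e2 _); rewrite -k1.
Qed.

Lemma tangle_equiv_move t l r : (forall i, flat_move (map (shift i) l) (map (shift i)
    r)) ->
  run t l -> run t l = run t r -> tangle_equiv t l r.
Proof.
move=> lr; case lE: (run t l) => [t'|] // _ rE; split; first by exists t'.
move=> a u v uE /=.
have kE : is_knot (u ++ map (shift (size a)) l ++ v) = is_knot (u ++ map (shift (size
  a)) r ++ v).
  apply: (is_knot_same_runs v (same_runs_move (lr _)) uE); rewrite run_shift ?lE //.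
  by rewrite -rE.
by split=> // k; apply: word_equiv_move; rewrite // -kE.
Qed.

Lemma tangle_equiv_ctx t p t1 l r q : run t p = Some t1 -> tangle_equiv t1 l r ->
  run t (p ++ l ++ q) -> tangle_equiv t (p ++ l ++ q) (p ++ r ++ q).
Proof.
move=> pE [[t' lE rE] lr].
have E x : run t1 x = Some t' -> run t (p ++ x ++ q) = run t' q.
  by move=> xE; rewrite run_cat pE /= run_cat xE.
case wE: (run t (p ++ l ++ q)) => [t2|] // _; split; first by exists t2;
  rewrite // E // -(E l).
move=> a u v uE /=; rewrite !map_cat -!catA.
have uE' : run [::] (u ++ map (shift (size a)) p) = Some (a ++ t1).
  by rewrite run_cat uE /= run_shift pE.
by have := lr _ _ (map (shift (size a)) q ++ v) uE'; rewrite /= -!catA.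
Qed.

Lemma tangle_equiv_shift b t l r : tangle_equiv t l r ->
  tangle_equiv (b ++ t) (map (shift (size b)) l) (map (shift (size b)) r).
Proof.
move=> [[t' lE rE] lr]; split; first by exists (b ++ t'); rewrite run_shift ?lE ?rE.
move=> a u v uE /=.
have E x : map (shift (size a)) (map (shift (size b)) x) = map (shift (size (a ++ b))) x.
  rewrite -map_comp; apply: eq_map => s; rewrite /= /shift /= size_cat.
  by rewrite -addnA [(size b + _)%N]addnC.
by rewrite !E; apply: lr; rewrite -catA.
Qed.

(** Unlike [erase], this forgets only the over/under information and keeps virtual crossings and
    double points apart. *)
Definition flatten_slice (s : slice) : slice :=
  if s is (i, Cross Under) then (i, Cross Over) else s.

Lemma run_flatten t w : run t (map flatten_slice w) = run t w.
Proof.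
rewrite -run_erase -map_comp -[RHS]run_erase; congr run.
by apply: eq_map => -[i [o||[]]].
Qed.

Lemma tangle_equiv_flatten t l : run t l -> tangle_equiv t l (map flatten_slice l).
Proof.
elim: l t => [|x l IHl] t; first exact: tangle_equiv_refl.
rewrite run_cons; case E: (step t x) => [t1|] // lE.
have xE : run t [:: x] = Some t1 by rewrite run_cons E.
have xl : tangle_equiv t [:: x] [:: flatten_slice x].
  have [xU|] := eqVneq x.2 (Cross Under).
    apply: tangle_equiv_move; rewrite ?xE //.
      by case: x xU {E xE} => i e /= -> j; apply: (Crossing_change _ (c := Under)).
    by rewrite -[X in _ = run _ X]/(map flatten_slice [:: x]) run_flatten.
  by case: x xE {E} => i [o||[]] xE //= _; apply: tangle_equiv_refl; rewrite xE.
apply: (@tangle_equiv_trans _ _ (flatten_slice x :: l)).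
  have := @tangle_equiv_ctx t [::] t _ _ l erefl xl; apply.
  by rewrite run_cons E.
have := @tangle_equiv_ctx t [:: flatten_slice x] t1 _ _ [::] _ (IHl _ lE).
have xE' : run t [:: flatten_slice x] = Some t1.
  by rewrite -[[:: _]]/(map flatten_slice [:: x]) run_flatten.
by rewrite !cats0; apply; rewrite // run_cat xE'.
Qed.

(** A flat move in either direction, up to the choice of over and under. The representatives [l']
    and [r'] absorb the decorations that a move prescribes, such as the opposite crossings of a
    second move. *)
Definition flat_local (l r : word) : Prop := exists l' r' : word,
  [/\ map flatten_slice l' = map flatten_slice l,
      map flatten_slice r' = map flatten_slice r &
      (forall i, flat_move (map (shift i) l') (map (shift i) r')) \/
      (forall i, flat_move (map (shift i) r') (map (shift i) l'))].

Lemma flat_local_sym l r : flat_local l r -> flat_local r l.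
Proof. by move=> [l' [r' [lE rE lr]]]; exists r', l'; split=> //; case: lr;
  [right|left]. Qed.

Lemma flat_local_tangle t l r : flat_local l r -> run t l -> run t l = run t r ->
  tangle_equiv t l r.
Proof.
move=> [l' [r' [lE rE lr]]] lok lrun.
have lok' : run t l' by rewrite -run_flatten lE run_flatten.
have lrun' : run t l' = run t r'.
  by rewrite -run_flatten lE run_flatten lrun -run_flatten -rE run_flatten.
apply: (@tangle_equiv_trans _ _ l').
  apply: tangle_equiv_trans (tangle_equiv_flatten lok) _.
  by rewrite -lE; apply/tangle_equiv_sym/tangle_equiv_flatten.
apply: (@tangle_equiv_trans _ _ r'); last first.
  apply: (@tangle_equiv_trans _ _ (map flatten_slice r')).
    by apply: tangle_equiv_flatten; rewrite -lrun'.
  by rewrite rE; apply/tangle_equiv_sym/tangle_equiv_flatten; rewrite -lrun.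
case: lr => lr; first exact: tangle_equiv_move.
by apply/tangle_equiv_sym/tangle_equiv_move; rewrite // -lrun'.
Qed.

(** One rewriting step at position [k]. All side conditions can be settled by computation, so a
    derivation becomes a list of positions and moves. *)
Lemma tangle_step k t t1 l r w w' : run t (take k w) = Some t1 ->
  tangle_equiv t1 l r -> take (size l) (drop k w) = l -> run t w ->
  tangle_equiv t (take k w ++ r ++ drop (size l) (drop k w)) w' -> tangle_equiv t w w'.
Proof.
move=> kE lr lE wE; apply: tangle_equiv_trans.
have E : take k w ++ l ++ drop (size l) (drop k w) = w by rewrite -{1}lE !cat_take_drop.
by rewrite -[X in tangle_equiv _ X _]E; apply: tangle_equiv_ctx kE lr _; rewrite E.
Qed.

Lemma flat_step k t l r w w' : flat_local l r -> take (size l) (drop k w) = l ->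
  run t w -> (if run t (take k w) is Some t1 then run t1 l = run t1 r else True) ->
  tangle_equiv t (take k w ++ r ++ drop (size l) (drop k w)) w' -> tangle_equiv t w w'.
Proof.
move=> lr lE wok; case kE: (run t (take k w)) => [t1|]; last first.
  by move: wok; rewrite -(cat_take_drop k w) run_cat kE.
move=> t1E; apply: (tangle_step kE _ lE wok); apply: flat_local_tangle t1E => //.
move: wok; rewrite -(cat_take_drop k w) -(cat_take_drop (size l) (drop k w)) lE.
by rewrite run_cat kE /= run_cat; case: (run t1 l).
Qed.

(* [flat_local] does not distinguish [Over] from [Under]: [X] is a flat crossing. *)
Local Notation X := (Cross Over).
Local Notation D := (Cross Double).

Lemma flat_exchange j e d f :
  flat_local [:: (j, e); (j + wout e + d, f)%N] [:: (j + win e + d, f)%N; (j, e)].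
Proof.
eexists _, _; split; [reflexivity|reflexivity|left => i].
have E n : (n + d + i = n + i + d)%N by rewrite addnAC.
have E' n : (j + n + i = j + i + n)%N by rewrite addnAC.
rewrite /= /shift /= !E !E'; exact/Flat_framed/Planar/Exchange.
Qed.

Lemma flat_zigzag j o : flat_local [:: (j.+1, Cup o); (j, Cap)] [::].
Proof.
by eexists _, _; split; [reflexivity|reflexivity|left => i];
  apply/Flat_framed/Planar/Zigzag.
Qed.

Lemma flat_zagzig j o : flat_local [:: (j, Cup o); (j.+1, Cap)] [::].
Proof.
by eexists _, _; split; [reflexivity|reflexivity|left => i];
  apply/Flat_framed/Planar/Zagzig.
Qed.

Lemma flat_turn_cap j c :
  flat_local [:: (j, Cross c); (j.+1, Cap)] [:: (j.+1, Cross c); (j, Cap)].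
Proof.
exists [:: (j, Cross c); (j.+1, Cap)], [:: (j.+1, Cross (swap c)); (j, Cap)].
by split; [|case: c|left => i; apply/Flat_framed/Planar/Turn_cap].
Qed.

Lemma flat_turn_cup j o c :
  flat_local [:: (j, Cup o); (j.+1, Cross c)] [:: (j.+1, Cup o); (j, Cross c)].
Proof.
exists [:: (j, Cup o); (j.+1, Cross c)], [:: (j.+1, Cup o); (j, Cross (swap c))].
by split; [|case: c|left => i; apply/Flat_framed/Planar/Turn_cup].
Qed.

Lemma flat_cancel j : flat_local [:: (j, X); (j, X)] [::].
Proof.
exists [:: (j, X); (j, Cross Under)], [::].
by split=> //; left => i; apply/Flat_framed/(@R2 _ Over).
Qed.

Lemma flat_twist j : flat_local [:: (j, D); (j, X)] [:: (j, X); (j, D)].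
Proof.
eexists _, _; split; [reflexivity|reflexivity|left => i].
by apply/Flat_framed/(@Rigid_twist _ Over).
Qed.

(** In flat terms no signs need to be opposite: any two classical curls cancel. *)
Lemma flat_kinks r r' j o o' : flat_local (kink r j o Over ++ kink r' j o' Over) [::].
Proof.
exists (kink r j o Over ++ kink r' j o' Under), [::]; split=> //.
  by case: r; case: r'.
by left => i; have := @Framed_R1 r r' (j + i) o o' Over isT; case: r; case: r' => ?;
  apply: Flat_framed.
Qed.

Lemma flat_slide1 j : flat_local (triangle j Double Over Over) (triangle' j Double Over
    Over).
Proof.
eexists _, _; split; [reflexivity|reflexivity|left => i].
(* With [m := Under], the two crossings decorated [swap m] are [Over]. *)
by apply/Flat_framed/(@Slide3 _ Under Double).
Qed.

Lemma flat_slide2 j : flat_local (triangle j Over Double Over) (triangle' j Over Double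
    Over).
Proof.
exists (triangle j Under Double Over), (triangle' j Under Double Over).
by split=> //; left => i; apply/Flat_framed/(@Slide2 _ Over Double).
Qed.

Ltac solve_run := repeat first
  [ done | progress rewrite /= ?take0 ?drop0 | progress rewrite /kink ].

(** [mv k H] rewrites the slices from position [k] on by the flat move [H], and [mvr] does so
    backwards; [sub] below uses a tangle equivalence already proved. *)
Ltac mv k H := eapply (@flat_step k);
  [ eapply H | reflexivity | solve_run | solve_run | rewrite /= ?addn0 ].
Ltac mvr k H := eapply (@flat_step k);
  [ apply: flat_local_sym; eapply H | reflexivity | solve_run | solve_run | rewrite /=
    ?addn0 ].

(** * Curls *)

Ltac done_refl := apply: tangle_equiv_refl; solve_run.

Ltac sub k H := eapply (@tangle_step k);
  [ repeat (progress rewrite /= ?take0 ?drop0);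
    reflexivity | eapply H | reflexivity | solve_run | rewrite /= ?addn0 ].

(** A zigzag created above the minimum makes the crossing turn into an outer curl of the left
    strand. By the next lemma the twist is equally an outer curl of the right strand, which is how a
    curl gets past a minimum. The crossing exchanges the two strands, hence the orientation [~~ o]
    of the remaining minimum. *)
Lemma cup_twist_left c o b :
  tangle_equiv b [:: (0%N, Cup o); (0%N, Cross c)] ((0%N, Cup (~~ o)) :: kink false 0 o
    c).
Proof.
let chain o :=
  mvr 1%N (@flat_zigzag 0 (~~ o));
  mv 2%N (@flat_exchange 0 Cap 0 (Cross c));
  mv 1%N (@flat_turn_cup 1 (~~ o) c);
  mv 0%N (@flat_exchange 0 (Cup o) 0 (Cup (~~ o)));
  done_refl
in case: o; [chain true | chain false].
Qed.

Lemma cup_twist_right c o b :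
  tangle_equiv b [:: (0%N, Cup o); (0%N, Cross c)] ((0%N, Cup (~~ o)) :: kink true 1 o c).
Proof.
let chain o :=
  mvr 1%N (@flat_zagzig 1 (~~ o));
  mvr 2%N (@flat_exchange 0 (Cross c) 0 Cap);
  mvr 1%N (@flat_turn_cup 0 (~~ o) c);
  mvr 0%N (@flat_exchange 0 (Cup (~~ o)) 0 (Cup o));
  done_refl
in case: o; [chain true | chain false].
Qed.

Lemma cap_twist_left c p b :
  tangle_equiv (p :: ~~ p :: b) (kink false 0 (~~ p) c ++ [:: (0%N, Cap)])
    [:: (0%N, Cross c); (0%N, Cap)].
Proof.
let chain p :=
  mv 2%N (@flat_exchange 0 Cap 0 Cap);
  mv 1%N (@flat_turn_cap 1 c);
  mv 0%N (@flat_exchange 0 (Cup (~~ p)) 0 (Cross c));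
  mv 1%N (@flat_zagzig 0 (~~ p));
  done_refl
in case: p; [chain true | chain false].
Qed.

Lemma cap_twist_right c p b :
  tangle_equiv (p :: ~~ p :: b) (kink true 1 (~~ p) c ++ [:: (0%N, Cap)])
    [:: (0%N, Cross c); (0%N, Cap)].
Proof.
let chain p :=
  mvr 2%N (@flat_exchange 0 Cap 0 Cap);
  mvr 1%N (@flat_turn_cap 0 c);
  mvr 0%N (@flat_exchange 0 (Cross c) 0 (Cup (~~ p)));
  mv 1%N (@flat_zigzag 1 (~~ p));
  done_refl
in case: p; [chain true | chain false].
Qed.

(* A pair of cancelling crossings is inserted in the curl and turned around the
   double point, which then sits in a curl on the other side. *)
Lemma double_kink_turn s b :
  tangle_equiv (s :: b) (kink true 0 s Double) (kink false 0 (~~ s) Double).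
Proof.
let chain s :=
  mvr 1%N (@flat_cancel 0);
  mvr 2%N (@flat_twist 0);
  mvr 0%N (@flat_turn_cup 0 s Over);
  mv 3%N (@flat_turn_cap 0 Over);
  (* An arc slides across the double point. The two crossings left over sit next to the minimum and
     the maximum of the loop; they become two curls of the loop, which cancel at the end. *)
  mvr 1%N (@flat_slide2 0);
  sub 0%N (@cup_twist_left Over s (s :: b));
  mv 3%N (@flat_exchange 0 Cap 1 D);
  mv 2%N (@flat_exchange 1 X 0 D);
  mv 1%N (@flat_exchange 0 (Cup s) 1 D);
  sub 5%N (tangle_equiv_sym (@cap_twist_left Over (~~ s) (s :: b)));
  mv 2%N (@flat_kinks false false 0 s s);
  done_refl
in case: s; [chain true | chain false].
Qed.

(** The strand [q] is pulled across the whole curl: a second move adds two crossings, a third move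
    passes the double point, and two crossings cancel again once turned past the minimum and the
    maximum. *)
Lemma double_kink_cross_right s q b :
  tangle_equiv (s :: q :: b) (kink false 0 (~~ s) Double ++ [:: (0%N, X)])
    ((0%N, X) :: kink false 1 (~~ s) Double).
Proof.
let chain s q :=
  mv 2%N (@flat_exchange 0 Cap 0 X);
  mvr 3%N (@flat_cancel 1);
  mv 1%N (@flat_slide1 1);
  mv 0%N (@flat_exchange 0 (Cup (~~ s)) 0 X);
  mv 1%N (@flat_turn_cup 0 (~~ s) Over);
  mvr 4%N (@flat_turn_cap 0 Over);
  mv 2%N (@flat_exchange 0 X 0 D);
  mv 3%N (@flat_cancel 0);
  done_refl
in case: s; case: q;
   [chain true true | chain true false | chain false true | chain false false].
Qed.

(** Conjugation by a flat crossing, which is its own inverse, reduces this to the previous lemma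
    read backwards. *)
Lemma double_kink_cross_left s q b :
  tangle_equiv (q :: s :: b) (kink false 1 (~~ s) Double ++ [:: (0%N, X)])
    ((0%N, X) :: kink false 0 (~~ s) Double).
Proof.
let chain s q :=
  mvr 0%N (@flat_cancel 0);
  sub 1%N (tangle_equiv_sym (@double_kink_cross_right s q b));
  mv 4%N (@flat_cancel 0);
  done_refl
in case: s; case: q;
   [chain true true | chain true false | chain false true | chain false false].
Qed.

(** Beyond the maximum the curl arrives on the right of the other strand; [double_kink_turn] brings
    it back to the left. *)
Lemma double_kink_around_cap p b :
  tangle_equiv (p :: ~~ p :: b) (kink false 0 (~~ p) Double ++ [:: (0%N, Cap)])
    (kink false 1 p Double ++ [:: (0%N, Cap)]).
Proof.
apply: tangle_equiv_trans (cap_twist_left _ _ _) _.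
apply: tangle_equiv_trans (tangle_equiv_sym (cap_twist_right _ _ _)) _.
let chain p :=
  sub 0%N (@tangle_equiv_shift [:: p] _ _ _ (@double_kink_turn (~~ p) b));
  done_refl
in case: p; [chain true | chain false].
Qed.

Lemma double_kink_around_cup o b :
  tangle_equiv b ((0%N, Cup o) :: kink false 1 o Double)
    ((0%N, Cup o) :: kink false 0 (~~ o) Double).
Proof.
let chain o :=
  sub 1%N (tangle_equiv_sym (@tangle_equiv_shift [:: o] _ _ _ (@double_kink_turn (~~ o)
    b)));
  sub 0%N (tangle_equiv_sym (@cup_twist_right Double (~~ o) b));
  sub 0%N (@cup_twist_left Double (~~ o) b);
  done_refl
in case: o; [chain true | chain false].
Qed.

(* The curl with the double point travels along the other curl. *)
Lemma double_kink_commute s b :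
  tangle_equiv (s :: b)
    (kink false 0 (~~ s) Double ++ kink true 0 s Over)
    (kink true 0 s Over ++ kink false 0 (~~ s) Double).
Proof.
let chain s :=
  mv 2%N (@flat_exchange 0 Cap 1 (Cup s));
  mv 1%N (@flat_exchange 1 D 0 (Cup s));
  mv 0%N (@flat_exchange 0 (Cup (~~ s)) 1 (Cup s));
  sub 1%N (@double_kink_cross_right s s (~~ s :: b));
  (* The small curl now lies on the loop of the other one. It goes over the maximum of this loop,
     down its right side and around its minimum. *)
  sub 2%N (@tangle_equiv_shift [:: s] _ _ _ (@double_kink_around_cap s b));
  mv 1%N (@flat_exchange 0 X 0 (Cup s));
  mv 2%N (@flat_exchange 0 X 1 D);
  mv 3%N (@flat_exchange 0 X 0 Cap);
  sub 0%N (@tangle_equiv_shift [:: s] _ _ _ (@double_kink_around_cup s b));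
  (* The second passage through the crossing brings the small curl to the upper end of the
     strand. *)
  sub 1%N (@double_kink_cross_left s s (~~ s :: b));
  mv 4%N (@flat_exchange 0 Cap 1 Cap);
  mv 3%N (@flat_exchange 1 D 0 Cap);
  mv 2%N (@flat_exchange 0 (Cup (~~ s)) 1 Cap);
  done_refl
in case: s; [chain true | chain false].
Qed.

(** Two copies of the second curl are created above the first, and one of them cancels it. *)
Lemma flat_kink_turn r r' s b :
  tangle_equiv (s :: b) (kink r 0 (if r then s else ~~ s) Over)
    (kink r' 0 (if r' then s else ~~ s) Over).
Proof.
let chain r r' s :=
  mvr 3%N (@flat_kinks r' r' 0 (if r' then s else ~~ s) (if r' then s else ~~ s));
  mv 0%N (@flat_kinks r r' 0 (if r then s else ~~ s) (if r' then s else ~~ s));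
  done_refl
in case: r; case: r'; case: s;
  [chain true true true | chain true true false | chain true false true
  | chain true false false | chain false true true | chain false true false
  | chain false false true | chain false false false].
Qed.

(** The form needed for the framed first move. Both curls are turned to the sides handled by
    [double_kink_commute]; afterwards the lower curl is the classical one and both are turned
    back. *)
Lemma double_kink_swap r r' s b (o := if r then s else ~~ s) (o' :=
    if r' then s else ~~ s) :
  tangle_equiv (s :: b) (kink r 0 o Double ++ kink r' 0 o' Over)
    (kink r 0 o Over ++ kink r' 0 o' Double).
Proof.
have dk x : tangle_equiv (s :: b) (kink x 0 (if x then s else ~~ s) Double)
    (kink false 0 (~~ s) Double).
  case: x; first exact: double_kink_turn.
  by case: (s); done_refl.
let chain r r' s :=
  sub 0%N (dk r);
  sub 3%N (@flat_kink_turn r' true s b);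
  sub 0%N (@double_kink_commute s b);
  sub 0%N (@flat_kink_turn true r s b);
  sub 3%N (tangle_equiv_sym (dk r'));
  done_refl
in rewrite {}/o {}/o'; case: r; case: r'; case: s dk => dk;
  [chain true true true | chain true true false | chain true false true
  | chain true false false | chain false true true | chain false true false
  | chain false false true | chain false false false].
Qed.

(** * The glueing invariant *)

Lemma ndouble_cat w1 w2 : ndouble (w1 ++ w2) = (ndouble w1 + ndouble w2)%N.
Proof. exact: count_cat. Qed.

Lemma ndouble_base l r : base_move l r -> ndouble l = ndouble r.
Proof.
case=> {l r} //=.
- by move=> d e f; rewrite /ndouble /= !addn0 addnC.
- by case.
- by move=> o; case.
- by case; case=> o o'; case.
- by case.
- by case.
- by move=> m x _; rewrite /ndouble /= !addn0 addnC -addnA addnCA.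
- by move=> m x _; rewrite /ndouble /= !addn0 addnC -addnA addnCA.
- by move=> m x _; rewrite /ndouble /= !addn0 addnC -addnA addnCA.
- by case.
Qed.

Lemma ndouble_shift i w : ndouble (map (shift i) w) = ndouble w.
Proof. by rewrite /ndouble count_map; apply: eq_count => -[]. Qed.

Lemma ndouble_flat_move l r : flat_move l r -> ndouble l = ndouble r.
Proof.
case=> [{}l {}r /framed_move_base[i [l0 [r0 [-> -> lr]]]]|i []//].
by rewrite !ndouble_shift; apply: ndouble_base.
Qed.

Lemma ndouble_flat_equiv S S' : flat_equiv S S' -> ndouble S = ndouble S'.
Proof.
elim=> [x y [u [l [r [v [lr -> ->]]]]]|//|x y _ -> //|x y z _ -> _ -> //].
by rewrite !ndouble_cat (ndouble_flat_move lr).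
Qed.

Lemma framed_flat_equiv S S' : framed_equiv S S' -> flat_equiv S S'.
Proof.
elim=> [x y [u [l [r [v [lr xE yE]]]]]|x|x y _|x y z _ + _].
- by apply: rst_step; exists u, l, r, v; split=> //; apply: Flat_framed.
- exact: rst_refl.
- exact: rst_sym.
- exact: rst_trans.
Qed.

(* The class of a singular knot with one double point, as an element of the free
   group; zero for all other words. *)
Definition word_class (w : word) : {freeg flat_class1} :=
  if (insub w : option sdiagram) is Some T then
    if (insub T : option diagram1) is Some S1 then << class1 S1 >> else 0
  else 0.

Lemma word_class_diagram1 (S : diagram1) : word_class S = << class1 S >>.
Proof. by rewrite /word_class valK valK. Qed.

Lemma word_class_equiv w w' : word_equiv flat_move w w' -> word_class w = word_class w'.
Proof.
move=> [S [S' [<- <- e]]]; rewrite /word_class !valK.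
have nE := ndouble_flat_equiv e.
case: insubP => [S1 _ S1E|]; last by rewrite nE => n0; rewrite insubN.
case: insubP => [S1' _ S1'E|]; last by rewrite -nE -{1}S1E (sdiag1_ofP S1).
congr << _ >>; apply/eqmodP/asboolP.
by move: e; rewrite -S1E -S1'E.
Qed.

Lemma word_class_not_knot w : ~~ is_knot w -> word_class w = 0.
Proof. by move=> wN; rewrite /word_class insubN. Qed.

Lemma is_knot_erase_eq w w' : map erase w = map erase w' -> is_knot w = is_knot w'.
Proof. by move=> E; rewrite -is_knot_erase E is_knot_erase. Qed.

Lemma word_class_move u l r v : flat_move l r ->
  is_knot (u ++ l ++ v) = is_knot (u ++ r ++ v) ->
  word_class (u ++ l ++ v) = word_class (u ++ r ++ v).
Proof.
move=> lr kE; case: (boolP (is_knot (u ++ l ++ v))) => k.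
  by apply/word_class_equiv/word_equiv_move; rewrite -?kE.
by rewrite !word_class_not_knot -?kE.
Qed.

(** No knottedness hypothesis is required: if one side is not a knot neither is the other, and both
    classes vanish. *)
Lemma word_class_tangle t l r a u v : tangle_equiv t l r -> run [::] u = Some (a ++ t) ->
  word_class (u ++ map (shift (size a)) l ++ v) = word_class (u ++ map (shift (size a))
    r ++ v).
Proof.
move=> [_ lr] /lr-/(_ v) /= [kE e]; case: (boolP (is_knot (u ++ map (shift (size a)) l
  ++ v))) => k.
  exact/word_class_equiv/e.
by rewrite !word_class_not_knot -?kE.
Qed.

(** * The glueing sum, slice by slice *)

(** Indexed by all slices, with value zero away from classical crossings, so that sums split along
    concatenations. *)
Definition glue_term (w : word) (k : nat) : {freeg flat_class1} :=
  if is_classical (slice_at w k)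
  then sign_at w k *: word_class (set_word w k Double) else 0.

Definition glue_sum (w : word) : {freeg flat_class1} :=
  \sum_(0 <= k < size w) glue_term w k.

Lemma slice_at_ctx u l v k : (k < size l)%N ->
  slice_at (u ++ l ++ v) (size u + k) = slice_at l k.
Proof.
by move=> lt_k; rewrite /slice_at nth_cat ltnNge leq_addr /= addKn nth_cat lt_k.
Qed.

Lemma set_word_right u x k c : set_word (u ++ x) (size u + k) c = u ++ set_word x k c.
Proof.
rewrite /set_word {1}/slice_at nth_cat ltnNge leq_addr /= addKn -/(slice_at x k).
case: slice_at => i [o||c'] //.
by elim: u => // s u /= ->.
Qed.

Lemma set_word_left u x k c : (k < size u)%N ->
    set_word (u ++ x) k c = set_word u k c ++ x.
Proof.
move=> lt_k; rewrite /set_word {1}/slice_at nth_cat lt_k -/(slice_at u k).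
case: slice_at => i [o||c'] //.
by elim: u k lt_k => // s u IHu [|k] //= /IHu ->.
Qed.

Lemma level_left u x k : (k <= size u)%N -> level (u ++ x) k = level u k.
Proof. by move=> le_k; rewrite /level takel_cat. Qed.

Lemma coherent_left u x k : (k < size u)%N -> coherent (u ++ x) k = coherent u k.
Proof.
by move=> lt_k; rewrite /coherent level_left 1?ltnW // /slice_at nth_cat lt_k.
Qed.

Definition tangle_coherent (t : seq bool) (l : word) (k : nat) : bool :=
  let i := (slice_at l k).1 in let lev := odflt [::] (run t (take k l)) in
  nth false lev i == nth false lev i.+1.

Lemma coherent_right u x k st : run [::] u = Some st ->
  coherent (u ++ x) (size u + k) = tangle_coherent st x k.
Proof.
move=> uE; rewrite /coherent /level take_cat ltnNge leq_addr /= addKn run_cat uE /=.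
by rewrite /slice_at nth_cat ltnNge leq_addr /= addKn.
Qed.

Lemma tangle_coherent_cat t l v k : (k < size l)%N ->
  tangle_coherent t (l ++ v) k = tangle_coherent t l k.
Proof.
by move=> lt_k; rewrite /tangle_coherent takel_cat 1?ltnW // /slice_at nth_cat lt_k.
Qed.

Lemma slice_at_shift i l k : (k < size l)%N ->
  slice_at (map (shift i) l) k = shift i (slice_at l k).
Proof. by move=> lt_k; rewrite /slice_at (nth_map (0%N, Cap)). Qed.

Lemma tangle_coherent_shift a t l k : (k < size l)%N -> run t l ->
  tangle_coherent (a ++ t) (map (shift (size a)) l) k = tangle_coherent t l k.
Proof.
move=> lt_k lok; rewrite /tangle_coherent slice_at_shift // -map_take run_shift.
case kE: (run t (take k l)) => [t1|] /=; last first.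
  by move: lok; rewrite -(cat_take_drop k l) run_cat kE.
rewrite !nth_cat -[((slice_at l k).1 + size a).+1]addSn.
by rewrite ![(_ + size a < _)%N]ltnNge !leq_addl /= !addnK.
Qed.

Lemma set_word_shift i l k c : (k < size l)%N ->
  set_word (map (shift i) l) k c = map (shift i) (set_word l k c).
Proof.
move=> lt_k; rewrite /set_word slice_at_shift //;
  case E: (slice_at l k) => [j [o||c']] //=.
apply: (@eq_from_nth _ (0%N, Cap)).
  by rewrite size_map !size_set_nth size_map.
move=> k'; rewrite size_set_nth size_map (maxn_idPr lt_k) => lt_k'.
rewrite (nth_map (0%N, Cap)) ?size_set_nth ?(maxn_idPr lt_k) //.
rewrite !nth_set_nth /=; case: eqP => // _.
by rewrite (nth_map (0%N, Cap)).
Qed.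

Lemma sum_nat_addl (m n : nat) (F : nat -> {freeg flat_class1}) :
  \sum_(0 <= k < m + n) F k = \sum_(0 <= k < m) F k + \sum_(0 <= k < n) F (m + k)%N.
Proof.
rewrite (big_cat_nat (n := m)) ?leq_addr //=; congr (_ + _).
rewrite -{1}[m]add0n big_addn addKn; apply: eq_bigr => k _; by rewrite addnC.
Qed.

(** A crossing outside the tangle keeps its sign, since the orientations there are unchanged, and
    its two glued diagrams differ by the same replacement in a context with one double point more.
    Hence the last hypothesis ranges over all redecorations [u'], [v'] of the context. *)
Lemma glue_sum_local u l r v st st' : run [::] u = Some st ->
  run st l = Some st' -> run st r = Some st' ->
  (forall u' v', map erase u' = map erase u -> map erase v' = map erase v ->
     word_class (u' ++ l ++ v') = word_class (u' ++ r ++ v')) ->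
  glue_sum (u ++ l ++ v) - glue_sum (u ++ r ++ v) =
  \sum_(0 <= k < size l) glue_term (u ++ l ++ v) (size u + k) -
  \sum_(0 <= k < size r) glue_term (u ++ r ++ v) (size u + k).
Proof.
move=> uE lE rE lr.
have split_sum x : glue_sum (u ++ x ++ v) =
    \sum_(0 <= k < size u) glue_term (u ++ x ++ v) k +
    (\sum_(0 <= k < size x) glue_term (u ++ x ++ v) (size u + k) +
     \sum_(0 <= k < size v) glue_term (u ++ x ++ v) (size u + (size x + k))).
  by rewrite /glue_sum !size_cat !sum_nat_addl.
rewrite !split_sum.
have -> : \sum_(0 <= k < size u) glue_term (u ++ l ++ v) k =
          \sum_(0 <= k < size u) glue_term (u ++ r ++ v) k.
  apply: eq_big_nat => k /andP[_ lt_k].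
  rewrite /glue_term /sign_at !coherent_left // !set_word_left //.
  rewrite /slice_at !nth_cat lt_k; case: ifP => // _; congr (_ *: _).
  by apply: lr; rewrite ?erase_set.
have -> : \sum_(0 <= k < size v) glue_term (u ++ l ++ v) (size u + (size l + k)) =
          \sum_(0 <= k < size v) glue_term (u ++ r ++ v) (size u + (size r + k)).
  apply: eq_big_nat => k /andP[_ lt_k].
  rewrite /glue_term /sign_at !(coherent_right _ _ uE) !set_word_right.
  have slE x : slice_at (u ++ x ++ v) (size u + (size x + k)) = slice_at v k.
    by rewrite /slice_at nth_cat ltnNge leq_addr /= addKn nth_cat ltnNge leq_addr /=
      addKn.
  have cohE x : run st x = Some st' ->
      tangle_coherent st (x ++ v) (size x + k) = tangle_coherent st' v k.
    move=> xE; rewrite /tangle_coherent take_cat ltnNge leq_addr /= addKn run_cat xE /=.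
    by rewrite /slice_at nth_cat ltnNge leq_addr /= addKn.
  rewrite !slE !cohE //; case: ifP => // _; congr (_ *: _).
  by apply: lr; rewrite ?erase_set.
rewrite opprD addrACA subrr add0r opprD addrACA subrr addr0 //.
Qed.

(** * Contribution of a tangle to the glueing sum *)

Definition crossing_sign (c : decoration) (coh : bool) : int :=
  if (c == Over) == coh then 1 else -1.

Definition tangle_term (F : word -> {freeg flat_class1}) (t : seq bool) (l : word) k :=
  if slice_at l k is (i, Cross c) then
    if is_over_under c then
      crossing_sign c (tangle_coherent t l k) *: F (set_word l k Double)
    else 0
  else 0.

(* The part of [glue_sum] coming from the crossings of a tangle, [F] giving the
   classes of the diagrams in which it is inserted. *)
Definition tangle_sum (F : word -> {freeg flat_class1}) (t : seq bool) (l : word) :=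
  \sum_(0 <= k < size l) tangle_term F t l k.

Lemma glue_sum_tangle u a t l v (F := fun x => word_class (u ++ map (shift (size a)) x
    ++ v)) :
  run [::] u = Some (a ++ t) -> run t l ->
  \sum_(0 <= k < size (map (shift (size a)) l))
    glue_term (u ++ map (shift (size a)) l ++ v) (size u + k) = tangle_sum F t l.
Proof.
move=> uE lok; rewrite size_map; apply: eq_big_nat => k /andP[_ lt_k].
rewrite /glue_term /sign_at (coherent_right _ _ uE) tangle_coherent_cat ?size_map //.
rewrite tangle_coherent_shift // slice_at_ctx ?size_map // slice_at_shift //.
rewrite set_word_right set_word_left ?size_map // set_word_shift // /tangle_term.
by case: (slice_at l k) => i [o||[]].
Qed.

Lemma run_erase_eq t l l' : map erase l = map erase l' -> run t l = run t l'.
Proof. by move=> E; rewrite -run_erase E run_erase. Qed.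

Lemma tangle_equiv_same_flat t l l' : map flatten_slice l = map flatten_slice l' ->
  run t l -> tangle_equiv t l l'.
Proof.
move=> E lok; apply: tangle_equiv_trans (tangle_equiv_flatten lok) _.
rewrite E; apply/tangle_equiv_sym/tangle_equiv_flatten.
by rewrite -run_flatten -E run_flatten.
Qed.

(** The only property of the surrounding diagram that the local computations use. *)
Definition tangle_invariant (t : seq bool) (T : Type) (F : word -> T) : Prop :=
  forall l r, tangle_equiv t l r -> F l = F r.

Lemma tangle_invariant_flat T t (F : word -> T) l r l' r' : tangle_invariant t F ->
  flat_local l' r' ->
  map flatten_slice l' = map flatten_slice l ->
    map flatten_slice r' = map flatten_slice r ->
  run t l -> run t l = run t r -> F l = F r.
Proof.
move=> Finv [l1 [r1 [lE rE lr]]] lE' rE' lok lrE; apply/Finv/flat_local_tangle => //.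
by exists l1, r1; split; rewrite ?lE ?rE.
Qed.

Lemma tangle_sum2 F t x y : tangle_sum F t [:: x; y] =
  tangle_term F t [:: x; y] 0 + tangle_term F t [:: x; y] 1.
Proof. by rewrite /tangle_sum big_nat_recr // big_nat1. Qed.

Lemma tangle_sum3 F t x y z (l := [:: x; y; z]) : tangle_sum F t l =
  tangle_term F t l 0 + tangle_term F t l 1 + tangle_term F t l 2.
Proof. by rewrite /tangle_sum big_nat_recr // big_nat_recr // big_nat1. Qed.

Lemma tangle_term_cross F t l k i c : slice_at l k = (i, Cross c) -> is_over_under c ->
  tangle_term F t l k = crossing_sign c (tangle_coherent t l k) *: F (set_word l k
    Double).
Proof. by rewrite /tangle_term => -> ->. Qed.

Lemma tangle_term0 F t l k : ~~ is_classical (slice_at l k) -> tangle_term F t l k = 0.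
Proof. by rewrite /tangle_term; case: slice_at => i [o||[]]. Qed.

Lemma tangle_term_eq F t l r k k' i i' c c' :
  slice_at l k = (i, Cross c) -> slice_at r k' = (i', Cross c') ->
  is_over_under c = is_over_under c' ->
  (is_over_under c -> crossing_sign c (tangle_coherent t l k) = crossing_sign c'
    (tangle_coherent t r k')) ->
  (is_over_under c -> F (set_word l k Double) = F (set_word r k' Double)) ->
  tangle_term F t l k = tangle_term F t r k'.
Proof. by rewrite /tangle_term => -> -> <-; case: ifP => // _ -> // ->. Qed.

Lemma exchange_coherent t d e f (l := [:: (0, e); (wout e + d, f)]%N)
    (r := [:: (win e + d, f); (0, e)]%N) : run t l ->
  tangle_coherent t l 1 = tangle_coherent t r 0 /\
  (win e = 2 -> tangle_coherent t l 0 = tangle_coherent t r 1).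
Proof.
rewrite {}/l {}/r run_seq2; case tE: (step t (0%N, e)) => [t1|] //.
case/step_left: tE (tE) => x [x'] [t'] [tE t1E sx sx' ext] e_step.
rewrite (_ : obind _ (Some _) = step t1 (wout e + d, f)%N) // => f_step'.
have shE a : (size a + d, f)%N = shift (size a) (d, f) by rewrite /shift /= addnC.
have [t2 f_step] : exists t2, step t (win e + d, f)%N = Some (x ++ t2).
  move: f_step'; rewrite t1E tE -sx -sx' !shE !step_shift.
  by case: (step t' _) => // t2 _; exists t2.
have nth_size a n : nth false (a ++ t') (size a + n) = nth false t' n.
  by rewrite nth_cat ltnNge leq_addr /= addKn.
split.
  rewrite /tangle_coherent [slice_at _ _]/= [slice_at _ 0]/= [take _ _]/= [take 0 _]/=.
  rewrite run_seq1 e_step [run t [::]]/= ![odflt _ _]/= t1E tE -sx -sx'.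
  by rewrite -!addnS !nth_size.
rewrite -sx => sx2; move: f_step; rewrite -sx sx2 => f_step.
rewrite /tangle_coherent [slice_at _ _]/= [slice_at _ 1]/= [take _ _]/= [take 1 _]/=.
rewrite run_seq1 f_step ![odflt _ _]/= tE.
by case: x sx2 {tE f_step sx ext} => [|x0 [|x1 []]].
Qed.

Lemma tangle_sum_exchange t F d e f :
  tangle_invariant t F -> run t [:: (0, e); (wout e + d, f)]%N ->
  run t [:: (0, e); (wout e + d, f)]%N = run t [:: (win e + d, f); (0, e)]%N ->
  tangle_sum F t [:: (0, e); (wout e + d, f)]%N =
  tangle_sum F t [:: (win e + d, f); (0, e)]%N.
Proof.
move=> Finv lok lrE.
have F0 c : e = Cross c -> F [:: (0, Cross Double); (wout e + d, f)]%N =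
    F [:: (win e + d, f); (0, Cross Double)]%N.
  move=> eE; apply/Finv/flat_local_tangle.
  - by rewrite eE; apply: (flat_exchange 0 (Cross Double)).
  - by rewrite (@run_erase_eq _ _ [:: (0, e); (wout e + d, f)]%N) // eE.
  - rewrite (@run_erase_eq _ _ [:: (0, e); (wout e + d, f)]%N) ?eE //.
    by rewrite -eE lrE; apply: run_erase_eq; rewrite eE.
have F1 c : f = Cross c -> F [:: (0, e); (wout e + d, Cross Double)]%N =
    F [:: (win e + d, Cross Double); (0, e)]%N.
  move=> fE; apply/Finv/flat_local_tangle.
  - exact: (flat_exchange 0 e d (Cross Double)).
  - by rewrite (@run_erase_eq _ _ [:: (0, e); (wout e + d, f)]%N) // fE.
  - rewrite (@run_erase_eq _ _ [:: (0, e); (wout e + d, f)]%N) ?fE //.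
    by rewrite -fE lrE; apply: run_erase_eq; rewrite fE.
have [coh1 coh0] := exchange_coherent lok.
rewrite !tangle_sum2 addrC; congr (_ + _).
- case: f F1 {lok lrE F0 coh0} coh1 => [o||c] F1 coh1; try by rewrite !tangle_term0.
  apply: (@tangle_term_eq _ _ _ _ _ _ (wout e + d)%N (win e + d)%N c c) => // _.
    by rewrite coh1.
  exact: F1.
- case: e F0 {lok lrE F1 coh1} coh0 => [o||c] F0 coh0; try by rewrite !tangle_term0.
  apply: (@tangle_term_eq _ _ _ _ _ _ 0 0 c c) => // _; last exact: F0.
  by rewrite coh0.
Qed.

Lemma crossing_sign_swap c coh : is_over_under c ->
  crossing_sign (swap c) coh = - crossing_sign c coh.
Proof. by case: c; case: coh. Qed.

(** A quarter turn of a crossing flips both its decoration and its coherence, and so preserves the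
    sign. *)
Lemma crossing_sign_swapN c coh : is_over_under c ->
  crossing_sign (swap c) (~~ coh) = crossing_sign c coh.
Proof. by case: c; case: coh. Qed.

Lemma is_over_under_swap c : is_over_under (swap c) = is_over_under c.
Proof. by case: c. Qed.

Lemma tangle_sum_turn_cap t F c : tangle_invariant t F ->
  run t [:: (0%N, Cross c); (1%N, Cap)] ->
  tangle_sum F t [:: (0%N, Cross c); (1%N, Cap)] =
  tangle_sum F t [:: (1%N, Cross (swap c)); (0%N, Cap)].
Proof.
move=> Finv lok; rewrite !tangle_sum2 !(@tangle_term0 _ _ _ 1) // !addr0.
apply: (@tangle_term_eq _ _ _ _ _ _ 0 1 c (swap c)); rewrite ?is_over_under_swap // => cP.
  rewrite -crossing_sign_swapN //; congr crossing_sign.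
  rewrite /tangle_coherent /slice_at /=.
  by case: t lok {Finv} => [|p [|q [|r b]]] //=; case: p; case: q; case: r.
apply: (tangle_invariant_flat Finv (flat_turn_cap 0 Double)) => //.
by case: t lok {Finv} => [|p [|q [|r b]]] //=; case: p; case: q; case: r.
Qed.

Lemma tangle_sum_turn_cup t F o c : tangle_invariant t F ->
  run t [:: (0%N, Cup o); (1%N, Cross c)] ->
  tangle_sum F t [:: (0%N, Cup o); (1%N, Cross c)] =
  tangle_sum F t [:: (1%N, Cup o); (0%N, Cross (swap c))].
Proof.
move=> Finv lok; rewrite !tangle_sum2 !(@tangle_term0 _ _ _ 0) // !add0r.
have {}lok : (0 < size t)%N by case: t lok {Finv}; rewrite /= ?take0 ?drop0.
apply: (@tangle_term_eq _ _ _ _ _ _ 1 0 c (swap c)); rewrite ?is_over_under_swap // => cP.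
  rewrite -crossing_sign_swapN //; congr crossing_sign.
  rewrite /tangle_coherent /slice_at /=.
  by case: t lok {Finv} => [|p b] //= _; rewrite ?take0 ?drop0 /=; case: o; case: p.
apply: (tangle_invariant_flat Finv (flat_turn_cup 0 o Double)) => //.
by case: t lok {Finv} => [|p b] //= _; rewrite ?take0 ?drop0 /=; case: o; case: p.
by case: t lok {Finv} => [|p b] //= _; rewrite ?take0 ?drop0 /=; case: o; case: p.
Qed.

(** The two signs are opposite, and rigid vertex isotopy identifies the two glued diagrams up to
    flat equivalence. *)
Lemma tangle_sum_cancel t F c : tangle_invariant t F -> is_over_under c ->
  run t [:: (0%N, Cross c); (0%N, Cross (swap c))] ->
  tangle_sum F t [:: (0%N, Cross c); (0%N, Cross (swap c))] = 0.
Proof.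
move=> Finv cP lok; rewrite tangle_sum2.
rewrite (@tangle_term_cross _ _ _ 0 0 c) // (@tangle_term_cross _ _ _ 1 0 (swap c))
  ?is_over_under_swap //.
have -> : F (set_word [:: (0%N, Cross c); (0%N, Cross (swap c))] 0 Double) =
    F (set_word [:: (0%N, Cross c); (0%N, Cross (swap c))] 1 Double).
  apply: (tangle_invariant_flat Finv (flat_twist 0)).
  - by case: (c) cP.
  - by case: (c) cP.
  - by case: t lok {Finv} => [|p [|q b]].
  - by case: t lok {Finv} => [|p [|q b]].
rewrite -scalerDl crossing_sign_swap //.
suff -> : tangle_coherent t [:: (0%N, Cross c); (0%N, Cross (swap c))] 1 =
          tangle_coherent t [:: (0%N, Cross c); (0%N, Cross (swap c))] 0.
  by rewrite subrr scale0r.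
rewrite /tangle_coherent /slice_at /=.
by case: t lok {Finv} => [|p [|q b]] //= _; rewrite eq_sym.
Qed.

Lemma flat_slide3 j : flat_local (triangle j Over Over Double) (triangle' j Over Over
    Double).
Proof.
eexists _, _; split; [reflexivity|reflexivity|left => i].
by apply/Flat_framed/(@Slide1 _ Over Double).
Qed.

(** The crossing of a given pair of strands lies in slice [k] before the move and [2 - k] after it,
    with the same sign; the right-hand sum is reversed accordingly. *)
Lemma tangle_sum_triangle p q r b F a1 a2 a3 (t := [:: p, q, r & b]) :
  (is_over_under a1 -> F (triangle 0 Double a2 a3) = F (triangle' 0 Double a2 a3)) ->
  (is_over_under a2 -> F (triangle 0 a1 Double a3) = F (triangle' 0 a1 Double a3)) ->
  (is_over_under a3 -> F (triangle 0 a1 a2 Double) = F (triangle' 0 a1 a2 Double)) ->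
  tangle_sum F t (triangle 0 a1 a2 a3) = tangle_sum F t (triangle' 0 a1 a2 a3).
Proof.
move=> F1 F2 F3; rewrite !tangle_sum3 [RHS]addrC [X in _ = _ + X]addrC [RHS]addrA.
congr (_ + _ + _).
- exact: (@tangle_term_eq _ _ _ _ 0 2 0 1 a1 a1).
- exact: (@tangle_term_eq _ _ _ _ 1 1 1 0 a2 a2).
- exact: (@tangle_term_eq _ _ _ _ 2 0 0 1 a3 a3).
Qed.

Lemma triangle_invariant t F a1 a2 a3 b1 b2 b3 : tangle_invariant t F ->
  flat_local (triangle 0 b1 b2 b3) (triangle' 0 b1 b2 b3) ->
  map flatten_slice (triangle 0 b1 b2 b3) = map flatten_slice (triangle 0 a1 a2 a3) ->
  (2 < size t)%N ->
  F (triangle 0 a1 a2 a3) = F (triangle' 0 a1 a2 a3) :> {freeg flat_class1}.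
Proof.
move=> Finv lr E lt_t; apply: (tangle_invariant_flat Finv lr E).
- have fl i j x y : flatten_slice (i, Cross x) = flatten_slice (i, Cross y) ->
      flatten_slice (j, Cross x) = flatten_slice (j, Cross y) by case: x; case: y.
  case: E => E1 E2 E3; congr [:: _; _; _];
    [exact: (fl 0%N _ _ _ E3)|exact: (fl 1%N _ _ _ E2)|exact: (fl 0%N _ _ _ E1)].
- by case: t lt_t {Finv} => [|p [|q [|r b]]].
- by case: t lt_t {Finv} => [|p [|q [|r b]]].
Qed.

(** Any two of the three crossings share a strand; if both are virtual, this strand slides past the
    third crossing whatever its decoration. *)
Lemma flat_virtual_slide j a1 a2 a3 :
  count (pred1 Virtual) [:: a1; a2; a3] = 2%N -> 
  flat_local (triangle j a1 a2 a3) (triangle' j a1 a2 a3).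
Proof.
move=> v2; eexists _, _; split; [reflexivity|reflexivity|left => i].
have [[-> ->]|[-> ->]|[-> ->]] : [\/ a1 = Virtual /\ a2 = Virtual,
    a1 = Virtual /\ a3 = Virtual | a2 = Virtual /\ a3 = Virtual].
- by move: v2; case: a1; case: a2; case: a3 => //= _;
    first [by constructor 1 | by constructor 2 | by constructor 3].
- exact/Flat_framed/(@Slide1 _ Virtual).
- exact/Flat_framed/(@Slide2 _ Virtual).
- exact/Flat_framed/(@Slide3 _ Virtual).
Qed.

(** The cases cover what [may_slide] permits without double points. Glueing one of three classical
    crossings leaves a strand with two classical crossings, which may be taken as the sliding one in
    flat terms. *)
Lemma tangle_sum_slides t F a1 a2 a3 : tangle_invariant t F -> (2 < size t)%N ->
  [|| all is_over_under [:: a1; a2; a3],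
      count (pred1 Virtual) [:: a1; a2; a3] == 2 |
      count (pred1 Virtual) [:: a1; a2; a3] == 3] ->
  tangle_sum F t (triangle 0 a1 a2 a3) = tangle_sum F t (triangle' 0 a1 a2 a3).
Proof.
move=> Finv lt_t; have T := triangle_invariant Finv.
case: t lt_t Finv T => [|p [|q [|r b]]] // _ _ T aP.
apply: tangle_sum_triangle => aiP.
- case/or3P: aP => [/and4P[_ a2P a3P _]|v2|v3].
  + by apply: (T _ _ _ _ _ _ (flat_slide1 0)) => //; case: (a2) a2P; case: (a3) a3P.
  + by apply: (T _ _ _ _ _ _ (@flat_virtual_slide 0 Double a2 a3 _)) => //; move: v2;
      case: (a1) aiP => //= _ /eqP.
  + by move: v3; case: (a1) aiP => //; case: (a2); case: (a3).
- case/or3P: aP => [/and4P[a1P _ a3P _]|v2|v3].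
  + by apply: (T _ _ _ _ _ _ (flat_slide2 0)) => //; case: (a1) a1P; case: (a3) a3P.
  + by apply: (T _ _ _ _ _ _ (@flat_virtual_slide 0 a1 Double a3 _)) => //; move: v2;
      case: (a2) aiP => //= _ /eqP.
  + by move: v3; case: (a2) aiP => //; case: (a1); case: (a3).
- case/or3P: aP => [/and4P[a1P a2P _ _]|v2|v3].
  + by apply: (T _ _ _ _ _ _ (flat_slide3 0)) => //; case: (a1) a1P; case: (a2) a2P.
  + by apply: (T _ _ _ _ _ _ (@flat_virtual_slide 0 a1 a2 Double _)) => //; move: v2;
      case: (a3) aiP => //= _ /eqP.
  + by move: v3; case: (a3) aiP => //; case: (a1); case: (a2).
Qed.

(** The crossing of a curl is always coherent, so the signs are given by the decorations and are
    opposite; the glued diagrams agree by [double_kink_swap]. *)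
Lemma tangle_sum_kinks t F r r' o o' c : tangle_invariant t F -> is_over_under c ->
  run t (kink r 0 o c ++ kink r' 0 o' (swap c)) ->
  tangle_sum F t (kink r 0 o c ++ kink r' 0 o' (swap c)) = 0.
Proof.
move=> Finv cP lok.
(* The orientation of each minimum is forced by that of the strand carrying the curls. *)
have [s [b [tE oE o'E]]] : exists s b,
    [/\ t = s :: b, o = (if r then s else ~~ s) & o' = (if r' then s else ~~ s)].
  case: t lok {Finv} => [|s b] lok; first by case: r lok.
  exists s, b; split=> //; move: lok; case: r; case: r'; case: o; case: o';
    case: s => //; by solve_run.
(* Each curl has its crossing in its middle slice, which gives positions 1 and 4. *)
have -> : tangle_sum F t (kink r 0 o c ++ kink r' 0 o' (swap c)) =
    tangle_term F t (kink r 0 o c ++ kink r' 0 o' (swap c)) 1 +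
    tangle_term F t (kink r 0 o c ++ kink r' 0 o' (swap c)) 4.
  rewrite /tangle_sum (_ : size _ = 6); last by case: r {lok oE}; case: r' {o'E}.
  do 5! rewrite big_nat_recr //; rewrite big_nat1.
  rewrite !(@tangle_term0 _ _ _ 0, @tangle_term0 _ _ _ 2, @tangle_term0 _ _ _ 3,
    @tangle_term0 _ _ _ 5);
    try by case: (r); case: (r').
  by rewrite /= !addr0 add0r.
have slE : slice_at (kink r 0 o c ++ kink r' 0 o' (swap c)) 1 = (~~ r : nat, Cross c).
  by case: (r).
have slE' : slice_at (kink r 0 o c ++ kink r' 0 o' (swap c)) 4 = (~~ r' :
  nat, Cross (swap c)).
  by case: (r); case: (r').
rewrite (tangle_term_cross _ _ slE) // (tangle_term_cross _ _ slE') ?is_over_under_swap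
  //.
have -> : F (set_word (kink r 0 o c ++ kink r' 0 o' (swap c)) 1 Double) =
    F (set_word (kink r 0 o c ++ kink r' 0 o' (swap c)) 4 Double).
  have -> : set_word (kink r 0 o c ++ kink r' 0 o' (swap c)) 1 Double =
      kink r 0 o Double ++ kink r' 0 o' (swap c) by case: (r); case: (r').
  have -> : set_word (kink r 0 o c ++ kink r' 0 o' (swap c)) 4 Double =
      kink r 0 o c ++ kink r' 0 o' Double by case: (r); case: (r').
  have lok1 : run t (kink r 0 o Double ++ kink r' 0 o' (swap c)).
    by rewrite (@run_erase_eq _ _ (kink r 0 o c ++ kink r' 0 o' (swap c))) //;
      case: (r); case: (r').
  have lok2 : run t (kink r 0 o c ++ kink r' 0 o' Double).
    by rewrite (@run_erase_eq _ _ (kink r 0 o c ++ kink r' 0 o' (swap c))) //;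
      case: (r); case: (r').
  rewrite (Finv _ _ (@tangle_equiv_same_flat _ _ (kink r 0 o Double ++ kink r' 0 o'
    Over) _ lok1)); last first.
    by case: (r); case: (r'); case: (c) cP.
  rewrite (Finv _ _ (@tangle_equiv_same_flat _ _ (kink r 0 o Over ++ kink r' 0 o'
    Double) _ lok2)); last first.
    by case: (r); case: (r'); case: (c) cP.
  by apply: Finv; rewrite tE oE o'E; apply: double_kink_swap.
rewrite -scalerDl crossing_sign_swap //.
suff [-> ->] : tangle_coherent t (kink r 0 o c ++ kink r' 0 o' (swap c)) 4 = true /\
          tangle_coherent t (kink r 0 o c ++ kink r' 0 o' (swap c)) 1 = true.
  by rewrite subrr scale0r.
rewrite tE oE o'E /tangle_coherent /slice_at; case: (r); case: (r'); case: (s);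
  by split; solve_run.
Qed.

Lemma tangle_sum_base t F l r : tangle_invariant t F -> base_move l r ->
  ndouble l = 0%N -> run t l -> run t r -> tangle_sum F t l = tangle_sum F t r.
Proof.
move=> Finv lr; have lrE : run t l -> run t r -> run t l = run t r.
  case lE: (run t l) => [t1|] // _; case rE: (run t r) => [t2|] // _.
  by rewrite (same_runs_base lr lE rE).1.
have sum0 : tangle_sum F t [::] = 0 by rewrite /tangle_sum big_nil.
have sum1 x : ~~ is_classical x -> tangle_sum F t [:: x] = 0.
  by move=> xN; rewrite /tangle_sum big_nat1 tangle_term0.
have size3 a1 a2 a3 : run t (triangle 0 a1 a2 a3) -> (2 < size t)%N.
  by case: (t) => [|p [|q [|s b]]].
case: lr lrE => {l r}.
- by move=> d e f lrE _ lok rok; apply: tangle_sum_exchange (lrE lok rok).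
- by move=> o _ _ _ _; rewrite tangle_sum2 !tangle_term0 // addr0 sum0.
- by move=> o _ _ _ _; rewrite tangle_sum2 !tangle_term0 // addr0 sum0.
- by move=> c _ _ lok _; apply: tangle_sum_turn_cap.
- by move=> o c _ _ lok _; apply: tangle_sum_turn_cup.
- by move=> r r' o o' c cP _ _ lok _; rewrite tangle_sum_kinks.
- move=> r o _ _ _ _; rewrite sum0; case: r;
    by rewrite [kink _ _ _ _]/= tangle_sum3 !tangle_term0 // !addr0.
- by move=> c cP _ _ lok _; rewrite tangle_sum_cancel.
- by move=> _ _ _ _; rewrite tangle_sum2 !tangle_term0 // addr0 sum0.
- move=> m x mx _ nd /size3 lt_t _; apply: tangle_sum_slides => //.
  by move: mx nd; case: (m); case: (x).
- move=> m x mx _ nd /size3 lt_t _; apply: tangle_sum_slides => //.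
  by move: mx nd; case: (m); case: (x).
- move=> m x mx _ nd /size3 lt_t _; apply: tangle_sum_slides => //.
  by move: mx nd; case: (m); case: (x).
- by [].
Qed.

(** * The glueing sum under framed moves and crossing changes *)

Lemma is_knot_run w : is_knot w -> run [::] w = Some [::].
Proof. by case/andP=> /eqP. Qed.

Lemma framed_move_split u l r v : framed_move l r ->
  is_knot (u ++ l ++ v) -> is_knot (u ++ r ++ v) ->
  exists a t l0 r0, [/\ l = map (shift (size a)) l0, r = map (shift (size a)) r0,
    base_move l0 r0, run [::] u = Some (a ++ t) & run t l0 /\ run t l0 = run t r0].
Proof.
move=> /framed_move_base[i [l0 [r0 [-> -> lr]]]] /is_knot_run/run_cat_Some[st uE].
case/run_cat_Some=> st1 lE _ /is_knot_run/run_cat_Some[st0]; rewrite uE => -[<-{st0}].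
case/run_cat_Some=> st2 rE _.
have le_i : (i <= size st)%N.
  case: l0 lr lE => [/base_move_nonempty//|x l0 _].
  rewrite map_cons run_cons => lE; apply: (@step_shift_le _ _ x).
  by case: step lE.
have [a [t [stE iE]]] : exists a t, st = a ++ t /\ i = size a.
  by exists (take i st), (drop i st); rewrite cat_take_drop size_takel.
move: lE rE; rewrite iE stE in uE *; rewrite !run_shift.
case lE: (run _ l0) => [t1|] // _; case rE: (run _ r0) => [t2|] // _.
exists a, t, l0, r0; split=> //.
by rewrite lE rE (same_runs_base lr lE rE).1.
Qed.

Lemma glue_sum_framed u l r v : framed_move l r ->
  is_knot (u ++ l ++ v) -> is_knot (u ++ r ++ v) -> ndouble l = 0%N ->
  glue_sum (u ++ l ++ v) = glue_sum (u ++ r ++ v).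
Proof.
move=> lr lk rk.
have [a [t [l0 [r0 [lE rE lr0 uE [lok lrE]]]]]] := framed_move_split lr lk rk.
rewrite lE ndouble_shift => nd.
case l0E: (run t l0) lok lrE => [t1|] // _ /esym r0E.
have lrunE : run (a ++ t) l = Some (a ++ t1) by rewrite lE run_shift l0E.
have rrunE : run (a ++ t) r = Some (a ++ t1) by rewrite rE run_shift r0E.
apply: subr0_eq; rewrite -lE (glue_sum_local uE lrunE rrunE); last first.
  move=> u' v' u'E v'E; apply: word_class_move; first exact: Flat_framed.
  apply: (is_knot_same_runs v' (same_runs_move (Flat_framed lr)) _ lrunE rrunE).
  by rewrite (run_erase_eq _ u'E).
rewrite {1 2}lE {1 2}rE !(glue_sum_tangle _ uE) ?l0E ?r0E //.
rewrite (tangle_sum_base _ lr0) ?subrr ?l0E ?r0E //.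
by move=> x y xy; apply: word_class_tangle uE.
Qed.

Lemma erase_cross u i c c' v :
  map erase (u ++ [:: (i, Cross c)] ++ v) = map erase (u ++ [:: (i, Cross c')] ++ v).
Proof. by rewrite !map_cat. Qed.

Lemma coherent_cross u i c c' v :
  coherent (u ++ [:: (i, Cross c)] ++ v) (size u) =
  coherent (u ++ [:: (i, Cross c')] ++ v) (size u).
Proof.
by rewrite /coherent /level !take_size_cat // /slice_at !nth_cat ltnn subnn.
Qed.

Lemma set_word_cross u i c c' v :
  set_word (u ++ [:: (i, Cross c)] ++ v) (size u) c' = u ++ [:: (i, Cross c')] ++ v.
Proof. by rewrite -[X in set_word _ X]addn0 set_word_right. Qed.

Lemma slice_at_cross u i c v : slice_at (u ++ [:: (i, Cross c)] ++ v) (size u) = (i,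
    Cross c).
Proof. by rewrite /slice_at nth_cat ltnn subnn. Qed.

Lemma glue_sum_crossing_change u i c v (w := fun x => u ++ [:: (i, Cross x)] ++ v) :
  is_over_under c -> is_knot (w c) ->
  glue_sum (w c) - glue_sum (w (swap c)) =
  (crossing_sign c (coherent (w c) (size u)) *: word_class (w Double)) *+ 2.
Proof.
move=> cP k; case/run_cat_Some: (is_knot_run k) => st uE /run_cat_Some[st1 cE _].
rewrite /w (glue_sum_local uE cE); last first.
- move=> u' v' _ _; apply: word_class_move; first exact: Crossing_change.
  exact/is_knot_erase_eq/erase_cross.
- by rewrite -cE; apply: run_erase_eq.
rewrite !big_nat1 addn0 /glue_term !slice_at_cross !set_word_cross.
rewrite /sign_at !slice_at_cross (coherent_cross u i (swap c) c).
rewrite mulr2n -/(w c); case: (c) cP; case: (coherent _ _) => //= _;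
  by rewrite ?scaleN1r ?opprK ?scale1r.
Qed.

(** * Extensions to singular knots *)

Definition word_extend (A : zmodType) (V : diagram -> A) (w : word) : A :=
  if (insub w : option sdiagram) is Some T then extend V T else 0.

Lemma word_extendE (A : zmodType) (V : diagram -> A) (S : sdiagram) :
    word_extend V S = extend V S.
Proof. by rewrite /word_extend valK. Qed.

Lemma ndouble_resolve_word w k p : is_knot w -> is_double (slice_at w k) ->
  ndouble w = (ndouble (set_word w k (signed p (coherent w k)))).+1.
Proof. by move=> wP kD; apply: (@ndouble_resolve (SDiagram wP) k p kD). Qed.

Lemma word_extend_skein (A : zmodType) (V : diagram -> A) w k : is_knot w ->
    is_double (slice_at w k) ->
  word_extend V w = word_extend V (set_word w k (signed true (coherent w k)))
                    - word_extend V (set_word w k (signed false (coherent w k))).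
Proof.
move=> wP kD; have := @extend_skein A V (SDiagram wP) k kD.
by rewrite -!word_extendE.
Qed.

Lemma word_extend_move (A : zmodType) (V : diagram -> A) u l r v : framed_invariant V ->
  framed_move l r -> is_knot (u ++ l ++ v) -> is_knot (u ++ r ++ v) ->
  ndouble (u ++ l ++ v) = 0%N -> word_extend V (u ++ l ++ v) = word_extend V (u ++ r ++
    v).
Proof.
move=> Vinv lr lk rk /eqP nd.
have nd' : ndouble (u ++ r ++ v) == 0%N.
  by move: nd; rewrite !ndouble_cat (ndouble_flat_move (Flat_framed lr)).
pose K := @Diagram (SDiagram lk) nd; pose K' := @Diagram (SDiagram rk) nd'.
rewrite -[u ++ l ++ v]/(word_of K) -[u ++ r ++ v]/(word_of K') !word_extendE
  !extend_diagram.
by apply: Vinv; apply: rst_step; exists u, l, r, v.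
Qed.

Lemma word_extend_resolve (A : zmodType) (V : diagram -> A) w w' k k' : is_knot w ->
    is_knot w' ->
  is_double (slice_at w k) -> is_double (slice_at w' k') ->
  (forall p, word_extend V (set_word w k (signed p (coherent w k))) =
             word_extend V (set_word w' k' (signed p (coherent w' k')))) ->
  word_extend V w = word_extend V w'.
Proof.
by move=> wP wP' kD kD' E; rewrite (word_extend_skein V wP kD) (word_extend_skein V wP'
  kD') !E.
Qed.

Lemma has_double w : (0 < ndouble w)%N ->
  exists2 k, (k < size w)%N & is_double (slice_at w k).
Proof.
by rewrite -has_count => /(has_nthP (0%N, Cap))[k lt_k kD]; exists k.
Qed.

Lemma signedN p coh : signed p (~~ coh) = swap (signed p coh).
Proof. by case: p; case: coh. Qed.

Lemma signed_classical p coh : is_over_under (signed p coh).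
Proof. by case: p; case: coh. Qed.

Lemma is_knot_base u a t l r v : base_move l r -> run [::] u = Some (a ++ t) ->
  run t l -> run t r ->
  is_knot (u ++ map (shift (size a)) l ++ v) = is_knot (u ++ map (shift (size a)) r ++ v).
Proof.
move=> lr uE; case lE: (run t l) => [t1|] // _; case rE: (run t r) => [t2|] // _.
by apply: (is_knot_same_runs v (same_runs_shift (same_runs_base lr) (base_move_nonempty
  lr)) uE);
  rewrite run_shift ?lE ?rE.
Qed.

Lemma word_extend_resolve_tangle (A : zmodType) (V : diagram -> A) u a t l r v k k'
    (w := fun x => u ++ map (shift (size a)) x ++ v) :
  run [::] u = Some (a ++ t) -> run t l -> run t r -> is_knot (w l) -> is_knot (w r) ->
  (k < size l)%N -> (k' < size r)%N ->
  is_double (slice_at l k) -> is_double (slice_at r k') ->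
  (forall p, word_extend V (w (set_word l k (signed p (tangle_coherent t l k)))) =
    word_extend V (w (set_word r k' (signed p (tangle_coherent t r k'))))) ->
  word_extend V (w l) = word_extend V (w r).
Proof.
move=> uE lok rok lk rk lt_k lt_k' kD kD' E.
have slE x j : (j < size x)%N -> slice_at (w x) (size u + j) = shift (size a) (slice_at
  x j).
  by move=> lt_j; rewrite slice_at_ctx ?size_map // slice_at_shift.
have setE x j c : (j < size x)%N -> set_word (w x) (size u + j) c = w (set_word x j c).
  by move=> lt_j; rewrite set_word_right set_word_left ?size_map // set_word_shift.
have cohE x j : (j < size x)%N -> run t x ->
    coherent (w x) (size u + j) = tangle_coherent t x j.
  move=> lt_j xok; rewrite (coherent_right _ _ uE) tangle_coherent_cat ?size_map //.
  by rewrite tangle_coherent_shift.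
apply: (@word_extend_resolve _ _ _ _ (size u + k) (size u + k')) => //.
- by rewrite slE.
- by rewrite slE.
- by move=> p; rewrite !setE // !cohE.
Qed.

Lemma erase_shift i w : map erase (map (shift i) w) = map (shift i) (map erase w).
Proof. by rewrite -!map_comp; apply: eq_map => -[j []]. Qed.

(** The double point takes part in the move. Resolving it with the same sign on both sides leaves
    two diagrams without double points, to which the invariance of [V] applies. *)
Lemma word_extend_base (A : zmodType) (V : diagram -> A) u a t l r v
    (w := fun x => u ++ map (shift (size a)) x ++ v) :
  framed_invariant V -> run [::] u = Some (a ++ t) ->
  base_move l r -> run t l -> run t l = run t r ->
  is_knot (w l) -> ndouble (w l) = 1%N -> ndouble l = 1%N ->
  word_extend V (w l) = word_extend V (w r).
Proof.
move=> Vinv uE lr lok lrE lk nd1 ndl.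
have wk x : map erase x = map erase l -> is_knot (w x).
  by move=> xE; rewrite (@is_knot_erase_eq _ (w l)) // !map_cat !erase_shift xE.
have move0 x y : base_move x y -> map erase x = map erase l -> run t x = run t y ->
    ndouble x = 0%N -> word_extend V (w x) = word_extend V (w y).
  move=> xy xE xyE x0; have xok : run t x by rewrite (run_erase_eq _ xE).
  apply: word_extend_move => //; first exact: base_move_framed.
  - exact: wk.
  - by rewrite -(is_knot_base _ xy uE) -?xyE //; apply: wk.
  - by move: nd1; rewrite !ndouble_cat !ndouble_shift ndl x0; lia.
have rk : is_knot (w r) by rewrite /w -(is_knot_base _ lr uE) -?lrE.
have rok : run t r by rewrite -lrE.
have resolve k k' : _ := @word_extend_resolve_tangle A V u a t l r v k k' uE lok rok lk
  rk.
move: ndl; case: lr lok lrE wk move0 resolve {lk nd1 rk rok} => {l r}.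
- move=> d e f lok lrE wk move0 resolve.
  have [coh1 coh0] := exchange_coherent lok.
  have run_eq e' f' : erase (0%N, e') = erase (0%N, e) -> erase (d, f') = erase (d, f) ->
      run t [:: (0, e'); (wout e' + d, f')]%N = run t [:: (win e' + d, f'); (0, e')]%N.
    move=> eE fE.
    have [wiE woE] : win e' = win e /\ wout e' = wout e.
      by case: (e) eE => [?||?]; case: (e') => [?||?].
    have fE' j : erase (j, f') = erase (j, f).
      by case: (f) fE => [?||?]; case: (f') => [?||?] //= [->].
    rewrite wiE woE (@run_erase_eq _ _ [:: (0, e); (wout e + d, f)]%N); last first.
      by rewrite !map_cons eE fE'.
    by rewrite lrE; apply: run_erase_eq; rewrite !map_cons eE fE'.
  have ndE : ndouble [:: (0, e); (wout e + d, f)]%N = (is_double (0%N, e) + is_double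
    (0%N, f))%N.
    by rewrite /ndouble /= addn0.
  rewrite ndE; case: (altP (e =P Cross Double)) => [eD|eD].
    rewrite {1}/is_double /= eD eqxx => fD.
    have {}fD : ~~ is_double (0%N, f) by case: is_double fD.
    rewrite eD in coh0 run_eq resolve move0 *.
    apply: (resolve 0%N 1%N) => // p; rewrite -coh0 //.
    have := signed_classical p (tangle_coherent t [:: (0%N, D); ((wout D + d)%N, f)] 0).
    move: (signed _ _) => c cP.
    apply: (move0 _ _ (Base_exchange d (Cross c) f)) => //; first exact: run_eq.
    by move/negPf: fD; rewrite /ndouble /is_double /= => ->; case: (c) cP.
  rewrite {1}/is_double /= (negPf eD) add0n; case: (altP (f =P Cross Double)) => [fD
    _|fD].
    rewrite fD in coh1 run_eq resolve move0 *.
    apply: (resolve 1%N 0%N) => // p; rewrite coh1.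
    have := signed_classical p (tangle_coherent t [:: ((win e + d)%N, D); (0%N, e)] 0).
    move: (signed _ _) => c cP.
    apply: (move0 _ _ (Base_exchange d e (Cross c))) => //; first exact: run_eq.
    by rewrite /ndouble /= addn0 /is_double /= (negPf eD); case: (c) cP.
  by rewrite /is_double /= (negPf fD).
- by [].
- by [].
- move=> c lok lrE wk move0 resolve nd.
  have cD : c = Double by case: (c) nd.
  rewrite cD in lok lrE resolve move0 *.
  apply: (resolve 0%N 0%N) => //= p.
  (* The quarter turn negates coherence, so the same sign is realised by the swapped decoration, as
     the move demands. *)
  have -> : tangle_coherent t [:: (1%N, D); (0%N, Cap)] 0 =
         ~~ tangle_coherent t [:: (0%N, D); (1%N, Cap)] 0.
    rewrite /tangle_coherent /slice_at /=.
    by case: (t) lok => [|x [|y [|z b]]] //=; case: x; case: y; case: z.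
  rewrite signedN; have := signed_classical p (tangle_coherent t [:: (0%N, D);
    (1%N, Cap)] 0).
  move: (signed _ _) => c' cP.
  apply: (move0 _ _ (Base_turn_cap c')) => //; last by case: (c') cP.
- move=> o c lok lrE wk move0 resolve nd.
  have cD : c = Double by case: (c) nd.
  rewrite cD in lok lrE resolve move0 *.
  apply: (resolve 1%N 1%N) => //= p.
  have -> : tangle_coherent t [:: (1%N, Cup o); (0%N, D)] 1 =
         ~~ tangle_coherent t [:: (0%N, Cup o); (1%N, D)] 1.
    have {}lok : (0 < size t)%N by case: (t) lok; rewrite /= ?take0 ?drop0.
    rewrite /tangle_coherent /slice_at /=.
    by case: (t) lok => [|x b] //= _; rewrite ?take0 ?drop0 /=; case: x; case: (o).
  rewrite signedN; have := signed_classical p (tangle_coherent t [:: (0%N, Cup o);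
    (1%N, D)] 1).
  move: (signed _ _) => c' cP.
  by apply: (move0 _ _ (Base_turn_cup o c')) => //; case: (c') cP.
- by case; case=> o o'; case.
- by case.
- by case.
- by [].
- move=> m x mx lok lrE wk move0 resolve nd.
  (* The sliding strand carries no double point, so the double point is the crossing slid past; the
     move stays legal when it is replaced by a classical crossing. *)
  have xD : x = Double by case: (m) mx nd; case: (x).
  rewrite xD in mx lok lrE resolve move0 *.
  apply: (resolve 2%N 0%N) => // p.
  have -> : tangle_coherent t (triangle' 0 m m Double) 0 = tangle_coherent t (triangle
    0 m m Double) 2.
    by case: (t) lok => [|? [|? [|? ?]]].
  have := signed_classical p (tangle_coherent t (triangle 0 m m Double) 2).
  move: (signed _ _) => c cP.
  by apply: (move0 _ _ (@Base_slide1 m c _)) => //; case: (m) mx; case: (c) cP.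
- move=> m x mx lok lrE wk move0 resolve nd.
  have xD : x = Double by case: (m) mx nd; case: (x).
  rewrite xD in mx lok lrE resolve move0 *.
  apply: (resolve 1%N 1%N) => // p.
  have -> : tangle_coherent t (triangle' 0 (swap m) Double m) 1 = tangle_coherent t
    (triangle 0 (swap m) Double m) 1.
    by case: (t) lok => [|? [|? [|? ?]]].
  have := signed_classical p (tangle_coherent t (triangle 0 (swap m) Double m) 1).
  move: (signed _ _) => c cP.
  by apply: (move0 _ _ (@Base_slide2 m c _)) => //; case: (m) mx; case: (c) cP.
- move=> m x mx lok lrE wk move0 resolve nd.
  have xD : x = Double by case: (m) mx nd; case: (x).
  rewrite xD in mx lok lrE resolve move0 *.
  apply: (resolve 0%N 2%N) => // p.
  have -> : tangle_coherent t (triangle' 0 Double (swap m) (swap m)) 2 =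
    tangle_coherent t (triangle 0 Double (swap m) (swap m)) 0.
    by case: (t) lok => [|? [|? [|? ?]]].
  have := signed_classical p (tangle_coherent t (triangle 0 Double (swap m) (swap m)) 0).
  move: (signed _ _) => c cP.
  by apply: (move0 _ _ (@Base_slide3 m c _)) => //; case: (m) mx; case: (c) cP.
- move=> c cP lok lrE wk move0 resolve _.
  apply: (resolve 0%N 1%N) => // p.
  have -> : tangle_coherent t [:: (0%N, Cross c);
    (0%N, D)] 1 = tangle_coherent t [:: (0%N, D); (0%N, Cross c)] 0.
    by case: (t) lok => [|? [|? ?]] //; rewrite /tangle_coherent /slice_at /= eq_sym.
  have := signed_classical p (tangle_coherent t [:: (0%N, D); (0%N, Cross c)] 0).
  move: (signed _ _) => c' cP'; rewrite /set_word /slice_at /=.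
  (* If the resolution equals [c], both sides are the same word; otherwise both cancel by a second
     move. *)
  have [->//|ne] := eqVneq c' c.
  have cE : c = swap c' by case: (c) cP ne; case: (c') cP'.
  have run0 : run t [:: (0, Cross c'); (0, Cross c)]%N = run t [::].
    by case: (t) lok => [|? [|? ?]].
  have run0' : run t [:: (0, Cross c); (0, Cross c')]%N = run t [::].
    by case: (t) lok => [|? [|? ?]].
  rewrite -!/(w _) cE in run0 run0' *.
  rewrite (move0 _ _ (Base_cancel cP')) //; last by case: (c') cP'.
  have cP2 : is_over_under (swap c') by rewrite -cE.
  have c'E : c' = swap (swap c') by case: (c').
  rewrite {2}c'E -(move0 _ _ (Base_cancel cP2)) -?c'E //.
  by case: (c') cP'.
Qed.

(** If the double point lies below or above the tangle, resolving it alters only the context, and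
    the same move relates the resolutions. *)
Lemma word_extend_framed (A : zmodType) (V : diagram -> A) u l r v :
  framed_invariant V -> framed_move l r ->
  is_knot (u ++ l ++ v) -> is_knot (u ++ r ++ v) -> ndouble (u ++ l ++ v) = 1%N ->
  word_extend V (u ++ l ++ v) = word_extend V (u ++ r ++ v).
Proof.
move=> Vinv lr lk rk nd.
have [a [t [l0 [r0 [lE rE lr0 uE [lok lrE]]]]]] := framed_move_split lr lk rk.
have ndlr := ndouble_flat_move (Flat_framed lr).
have [nl|nl] := posnP (ndouble l); last first.
  rewrite lE rE in lk nd nl *; apply: (word_extend_base Vinv uE lr0) => //.
  by move: nl nd; rewrite !ndouble_cat !ndouble_shift; lia.
have out k k' : is_double (slice_at (u ++ l ++ v) k) ->
  is_double (slice_at (u ++ r ++ v) k') ->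
    coherent (u ++ l ++ v) k = coherent (u ++ r ++ v) k' ->
    (forall c, exists u' v', set_word (u ++ l ++ v) k c = u' ++ l ++ v' /\
       set_word (u ++ r ++ v) k' c = u' ++ r ++ v') ->
    word_extend V (u ++ l ++ v) = word_extend V (u ++ r ++ v).
  move=> kD kD' cohE setE; apply: (word_extend_resolve lk rk kD kD') => p.
  have nd0 : ndouble (set_word (u ++ l ++ v) k (signed p (coherent (u ++ l ++ v) k))) =
    0%N.
    by apply: succn_inj; rewrite -(ndouble_resolve_word p lk kD).
  have := set_word_knot k (signed p (coherent (u ++ l ++ v) k)) lk.
  have := set_word_knot k' (signed p (coherent (u ++ r ++ v) k')) rk.
  rewrite -cohE; have [u' [v' [E E']]] := setE (signed p (coherent (u ++ l ++ v) k)).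
  by rewrite E in nd0 *; rewrite E' => k1 k2; apply: word_extend_move.
have [nu|/has_double[k lt_k kD]] := posnP (ndouble u); last first.
  have slE x : slice_at (u ++ x) k = slice_at u k by rewrite /slice_at nth_cat lt_k.
  apply: (out k k); rewrite ?slE ?coherent_left // => c.
  by exists (set_word u k c), v; rewrite !set_word_left.
have [k lt_k kD] : exists2 k, (k < size v)%N & is_double (slice_at v k).
  by apply: has_double; move: nd; rewrite !ndouble_cat nu nl !add0n => ->.
have slE x : slice_at (u ++ x ++ v) (size u + (size x + k)) = slice_at v k.
  by rewrite /slice_at nth_cat ltnNge leq_addr /= addKn nth_cat ltnNge leq_addr /= addKn.
apply: (out (size u + (size l + k))%N (size u + (size r + k))%N); rewrite ?slE //.
  have cohE x : run (a ++ t) x = run (a ++ t) l ->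
      tangle_coherent (a ++ t) (x ++ v) (size x + k) =
      tangle_coherent (odflt [::] (run (a ++ t) l)) v k.
    move=> xE; rewrite /tangle_coherent take_cat ltnNge leq_addr /= addKn run_cat xE /=.
    rewrite /slice_at nth_cat ltnNge leq_addr /= addKn.
    by rewrite lE run_shift; case: (run t l0) lok.
  by rewrite !(coherent_right _ _ uE) !cohE // lE rE !run_shift lrE.
by move=> c; exists u, (set_word v k c); rewrite !set_word_right.
Qed.

Lemma word_extend_crossing_change (A : zmodType) (V : diagram -> A) u i c v
    (w := fun x => u ++ [:: (i, Cross x)] ++ v) :
  is_over_under c -> is_knot (w c) ->
  word_extend V (w c) - word_extend V (w (swap c)) =
  word_extend V (w Double) *~ crossing_sign c (coherent (w c) (size u)).
Proof.
move=> cP k; have Dk : is_knot (w Double).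
  by rewrite -(is_knot_erase_eq (erase_cross u i c Double v)).
rewrite (@word_extend_skein _ V _ (size u) Dk) ?slice_at_cross // !set_word_cross.
rewrite (coherent_cross u i Double c) -!/(w _).
by case: (c) cP; case: (coherent _ _) => //= _; rewrite ?mulrNz ?mulr1z ?opprB.
Qed.

Lemma swap_classical_equiv u i c v : is_over_under c ->
  is_knot (u ++ [:: (i, Cross c)] ++ v) ->
  word_equiv flat_move (u ++ [:: (i, Cross c)] ++ v) (u ++ [:: (i, Cross (swap c))] ++ v).
Proof.
move=> cP k; apply: word_equiv_move => //; first exact: Crossing_change.
by rewrite -(is_knot_erase_eq (erase_cross u i c (swap c) v)).
Qed.

Lemma slice_at_split w k i c : slice_at w k = (i, Cross c) ->
  exists u v, [/\ w = u ++ [:: (i, Cross c)] ++ v & size u = k].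
Proof.
move=> kE; have lt_k : (k < size w)%N.
  by rewrite ltnNge; apply/negP => le; move: kE; rewrite /slice_at nth_default.
exists (take k w), (drop k.+1 w); rewrite size_takel 1?ltnW //; split=> //=.
by rewrite -kE -{1}(cat_take_drop k w) (drop_nth (0%N, Cap) lt_k).
Qed.

(** * Flat invariance of the extension *)

(** A crossing change alters the extension by its value on a knot with two double points, which is
    zero for an invariant of order at most one. *)
Lemma word_extend_flat (A : zmodType) (V : diagram -> A) (S S' : sdiagram) :
  vassiliev_le 1 V -> flat_equiv S S' -> ndouble S = 1%N -> extend V S = extend V S'.
Proof.
move=> [Vinv V1]; elim=> {S S'}.
- move=> S S' [u [l [r [v [lr SE S'E]]]]] nd.
  have lk := word_ofP S; have rk := word_ofP S'.
  rewrite -!word_extendE; rewrite SE in lk nd *; rewrite S'E in rk *.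
  case: lr lk rk nd {SE S'E} => [{}l {}r lr lk rk nd|i c cP lk rk nd];
    first exact: word_extend_framed.
  apply: subr0_eq; rewrite word_extend_crossing_change //.
  have Dk : is_knot (u ++ [:: (i, D)] ++ v).
    by rewrite -(is_knot_erase_eq (erase_cross u i c Double v)).
  rewrite -[_ ++ _]/(word_of (SDiagram Dk)) word_extendE V1 ?mul0rz //=.
  by move: nd; rewrite !ndouble_cat; case: (c) cP => //= _; rewrite /ndouble /=; lia.
- by [].
- by move=> S S' e IH nd; rewrite IH // (ndouble_flat_equiv e).
- by move=> S1 S2 S3 e IH _ IH' nd; rewrite IH // IH' // -(ndouble_flat_equiv e).
Qed.

(** [extend1] evaluates at the chosen representative of a class, which flat invariance makes
    harmless. *)
Lemma extend1_class (A : zmodType) (V : diagram -> A) (S : diagram1) :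
  vassiliev_le 1 V -> extend1 V << class1 S >> = extend V S.
Proof.
move=> V1; rewrite /extend1 liftU scale1r.
apply: word_extend_flat => //; last exact/eqP/sdiag1_ofP.
have /eqmodP/asboolP : (\pi_flat_class1 (repr (class1 S)) = \pi_flat_class1 S)%qT by
  rewrite reprK.
by [].
Qed.

Lemma extend1_sum (A : zmodType) (V : diagram -> A) : {morph extend1 V : x y / x - y}.
Proof. exact: (lift_is_additive (fun c : flat_class1 => extend V (repr c) :
  zmodule A)). Qed.

(** * The extension of the glueing invariant *)

Lemma glueingE (K : diagram) : glueing K = glue_sum K.
Proof.
rewrite /glueing /glue_sum big_mkord.
have -> : \sum_(k < size K) glue_term K k =
    \sum_(k : 'I_(size K) | is_classical (slice_at K k)) glue_term K k.
  by rewrite [RHS]big_mkcond; apply: eq_bigr => k _; rewrite /glue_term; case: ifP.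
rewrite (reindex_omap (val : crossing K -> 'I_(size K)) insub) => [|k kP] /=; last first.
  by rewrite insubT.
apply: eq_big => [d|d _]; first by rewrite valK eqxx (valP d).
rewrite /glue_term (valP d) /sgn; congr (_ *: _).
by rewrite -word_class_diagram1.
Qed.

Lemma word_extend_glueing w : is_knot w -> ndouble w = 0%N ->
  word_extend glueing w = glue_sum w.
Proof.
move=> k /eqP nd; pose K := @Diagram (SDiagram k) nd.
by rewrite -[w]/(word_of K) word_extendE extend_diagram glueingE.
Qed.

Lemma extend_glueing1 (S : sdiagram) : ndouble S = 1%N ->
  extend glueing S = word_class S *+ 2.
Proof.
move=> nd; have Sk := word_ofP S; rewrite -word_extendE.
have [k _ kD] : exists2 k, (k < size S)%N & is_double (slice_at S k).
  by apply: has_double; rewrite nd.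
have [i kE] : exists i, slice_at S k = (i, Cross Double).
  by case: slice_at kD => i e /eqP/= ->; exists i.
rewrite (word_extend_skein _ Sk kD).
have nd0 p : ndouble (set_word S k (signed p (coherent S k))) = 0%N.
  by apply: succn_inj; rewrite -ndouble_resolve_word.
rewrite !word_extend_glueing ?set_word_knot //.
have [u [v [SE uE]]] := slice_at_split kE; rewrite -uE SE in Sk *.
rewrite !set_word_cross; set coh := coherent _ _.
have -> : signed false coh = swap (signed true coh) by case: coh.
have ck : is_knot (u ++ [:: (i, Cross (signed true coh))] ++ v).
  by rewrite (is_knot_erase_eq (erase_cross u i _ Double v)).
rewrite glue_sum_crossing_change ?signed_classical // (coherent_cross u i _ Double).
(* By construction the crossing decorated [signed true coh] has sign +1. *)
by rewrite -/coh; case: coh {ck}; rewrite scale1r.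
Qed.

Lemma extend_glueing_gt1 (S : sdiagram) : (1 < ndouble S)%N -> extend glueing S = 0.
Proof.
have [n] := ubnP (ndouble S); elim: n S => // n IHn S lt_n gt1.
have [k _ kD] : exists2 k, (k < size S)%N & is_double (slice_at S k).
  by apply: has_double; apply: ltnW.
rewrite (extend_skein glueing kD).
have nd p : ndouble S = (ndouble (resolve S k p)).+1 by apply: ndouble_resolve.
(* With three or more double points both resolutions vanish by induction. With exactly two, the
   resolutions differ by a crossing change and so have the same flat class. *)
have [gt2|le2] := ltnP 2 (ndouble S).
  by rewrite !IHn ?subrr //; [have := nd false|have := nd false|have :=
    nd true|have := nd true]; lia.
have nd1 p : ndouble (resolve S k p) = 1%N by have := nd p; lia.
rewrite !extend_glueing1 //; apply/eqP; rewrite subr_eq0; apply/eqP; congr (_ *+ 2).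
apply: word_class_equiv.
have [i kE] : exists i, slice_at S k = (i, Cross Double).
  by case: slice_at kD => i e /eqP/= ->; exists i.
have [u [v [SE uE]]] := slice_at_split kE.
have rE p : resolve S k p = u ++ [:: (i, Cross (signed p (coherent S k)))] ++ v :> word.
  by rewrite /= -{1 2}uE SE set_word_cross uE.
have := word_ofP (resolve S k true); rewrite !rE.
have -> : signed false (coherent S k) = swap (signed true (coherent S k)) by case:
  coherent.
by apply: swap_classical_equiv; apply: signed_classical.
Qed.

(** A free abelian group has no 2-torsion; this makes the half of a difference unique. *)
Lemma freeg_mulr2n_inj (x y : {freeg flat_class1}) : x *+ 2 = y *+ 2 -> x = y.
Proof.
move=> xy; apply/eqP/freeg_eqP => z; have := congr1 (coeff z) xy.
by rewrite !coeffMn; lia.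
Qed.

(** * The universal formula *)

(** The half [x] is chosen before [V], as it depends only on the homotopy: a framed move contributes
    0, a crossing change its signed glued class, and contributions add up along the homotopy. *)
Lemma glue_sum_flat (S S' : sdiagram) : flat_equiv S S' -> ndouble S = 0%N ->
  exists2 x : {freeg flat_class1}, x *+ 2 = glue_sum S - glue_sum S' &
    forall (A : zmodType) (V : diagram -> A), vassiliev_le 1 V ->
      extend V S = extend V S' + extend1 V x.
Proof.
have ext0 (A : zmodType) (V : diagram -> A) : extend1 V 0 = 0.
  by have := extend1_sum V 0 0; rewrite !subrr.
have extN (A : zmodType) (V : diagram -> A) x : extend1 V (- x) = - extend1 V x.
  by rewrite -[- x]sub0r extend1_sum ext0 sub0r.
have extD (A : zmodType) (V : diagram -> A) x y :
  extend1 V (x + y) = extend1 V x + extend1 V y.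
  by rewrite -{1}[y]opprK extend1_sum extN opprK.
elim=> {S S'}.
- move=> S S' [u [l [r [v [lr SE S'E]]]]] nd.
  have lk := word_ofP S; have rk := word_ofP S'.
  suff : exists2 x : {freeg flat_class1}, x *+ 2 = glue_sum S - glue_sum S' &
    forall (A : zmodType) (V : diagram -> A), vassiliev_le 1 V ->
      word_extend V S = word_extend V S' + extend1 V x.
    by case=> x xE xV; exists x => // A V V1; rewrite -!word_extendE xV.
  rewrite SE in lk nd *; rewrite S'E in rk *.
  case: lr lk rk nd {SE S'E} => [{}l {}r lr lk rk nd|i c cP lk rk nd].
    exists 0.
      rewrite mul0rn (glue_sum_framed lr) ?subrr //.
      by move: nd; rewrite !ndouble_cat; lia.
    by move=> A V [Vinv _]; rewrite ext0 addr0; apply: word_extend_move.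
  have Dk : is_knot (u ++ [:: (i, D)] ++ v).
    by rewrite -(is_knot_erase_eq (erase_cross u i c Double v)).
  have nd1 : ndouble (SDiagram Dk) == 1%N.
    by move: nd; rewrite /= !ndouble_cat; case: (c) cP => //= _; rewrite /ndouble /=; lia.
  eexists; first by rewrite (glue_sum_crossing_change cP lk).
  move=> A V V1; apply/eqP; rewrite addrC -subr_eq word_extend_crossing_change //.
  rewrite -[u ++ [:: (i, D)] ++ v]/(word_of (Diagram1 nd1)) word_class_diagram1
    word_extendE.
  rewrite -(extend1_class (Diagram1 nd1) V1); apply/eqP.
  by rewrite /crossing_sign; case: ifP; rewrite ?mulrNz ?mulr1z ?scaleN1r ?scale1r ?extN.
- move=> S nd; exists 0; first by rewrite mul0rn subrr.
  by move=> A V _; rewrite ext0 addr0.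
- move=> S S' e IH nd; have [|x xE xV] := IH; first by rewrite (ndouble_flat_equiv e).
  exists (- x); first by rewrite mulNrn xE opprB.
  by move=> A V V1; rewrite (xV A V V1) extN addrK.
- move=> S1 S2 S3 e1 IH1 e2 IH2 nd.
  have [//|x xE xV] := IH1; have [|y yE yV] := IH2;
    first by rewrite -(ndouble_flat_equiv e1).
  exists (x + y); first by rewrite mulrnDl xE yE addrA subrK.
  by move=> A V V1; rewrite (xV A V V1) (yV A V V1) extD -addrA [extend1 V y + _]addrC.
Qed.

Lemma glueing_invariant : framed_invariant glueing.
Proof.
move=> K K'; rewrite !glueingE.
have := sdiag_ofP K; move: (sdiag_of K) (sdiag_of K') => {K K'} S S' /eqP nd e.
elim: e nd => {S S'} [S S' [u [l [r [v [lr SE S'E]]]]] nd|//|S S' e IH nd|S1 S2 S3 e1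
  IH1 e2 IH2 nd].
- have lk := word_ofP S; have rk := word_ofP S'.
  rewrite SE in lk nd *; rewrite S'E in rk *; apply: glue_sum_framed => //.
  by move: nd; rewrite !ndouble_cat; lia.
- by rewrite IH // (ndouble_flat_equiv (framed_flat_equiv e)).
- by rewrite IH1 // IH2 // -(ndouble_flat_equiv (framed_flat_equiv e1)).
Qed.

Lemma glueing_le1 : vassiliev_le 1 glueing.
Proof. by split; [exact: glueing_invariant | exact: extend_glueing_gt1]. Qed.

(* The figure eight with its double point, where [glueing] extends to twice a
   generator. *)
Lemma glueing_not_le0 : ~ vassiliev_le 0 glueing.
Proof.
(* The colouring count of [is_knotE] turns knottedness into a computation. *)
have k : is_knot [:: (0, Cup true); (0, D); (0, Cap)]%N by rewrite is_knotE.
have nd : ndouble (SDiagram k) == 1%N by [].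
case=> _ /(_ (SDiagram k) isT) /eqP; rewrite extend_glueing1 //.
by rewrite -[SDiagram k]/(sdiag1_of (Diagram1 nd)) word_class_diagram1 freegU_muln
  freegU_eq0.
Qed.

Theorem theorem15 :
  framed_invariant glueing /\
  vassiliev_order_one glueing /\
  (forall K K0 : diagram, homotopic K K0 ->
     exists! x : {freeg flat_class1}, x *+ 2 = glueing K - glueing K0) /\
  (forall (A : zmodType) (V : diagram -> A), vassiliev_le 1 V ->
     (forall S : diagram1, extend1 V << class1 S >> = extend V S) /\
     (forall (K K0 : diagram) (x : {freeg flat_class1}),
        homotopic K K0 -> x *+ 2 = glueing K - glueing K0 -> V K = V K0 + extend1 V x)).
Proof.
split; first exact: glueing_invariant.
split; first by split; [exact: glueing_le1 | exact: glueing_not_le0].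
split.
  move=> K K0 /glue_sum_flat[|x xE _]; first exact/eqP/sdiag_ofP.
  exists x; split; first by rewrite !glueingE.
  by move=> y yE; apply: freeg_mulr2n_inj; rewrite xE yE !glueingE.
move=> A V V1; split=> [S|K K0 x]; first exact: extend1_class.
move=> /glue_sum_flat[|y yE yV]; first exact/eqP/sdiag_ofP.
rewrite !glueingE -yE => /freeg_mulr2n_inj->.
by rewrite -!(extend_diagram V); apply: yV.
Qed.
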